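(* Let $b_1,\dots,b_N$ be random variables defined on a common probability space and taking values in $\{0,1\}$, with arbitrary joint law. For $h=(h_1,\dots,h_N)$ put $e_i:=e^{h_i}-1$. Then, as formal power series in $h_1,\dots,h_N$, $$W[h]:=\log \mathbb{E}\Big[e^{\sum_{i=1}^N h_i b_i}\Big]=\sum_H\frac{\mu(H^\bullet)}{|\mathrm{Aut}\,H|}\sum_{\mathcal L\in \mathrm{Lab}(H)}w(\mathcal L),$$ where the sum runs over isomorphism classes of finite connected simple bipartite graphs $H$ with at least two vertices, whose vertices are coloured black and white so that every edge joins a black vertex to a white vertex, and $$w(\mathcal L)=\prod_{\bullet}K(b_\bullet)\prod_{\text{edges of }H}e_i .$$ Here the first product is over the black vertices of $H$; for a black vertex $\bullet$ whose white neighbours have labels $u_1,\dots,u_k$ under $\mathcal L$, $K(b_\bullet):=K_k(b_{u_1},\dots,b_{u_k})$. In the second product, over the edges of $H$, $i$ is the label under $\mathcal L$ of the white endpoint of the edge.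
   Context: Cumulants: the joint cumulants $K_n$ of random variables are the symmetric multilinear forms determined by $\mathbb{E}[a_1\cdots a_n]=\sum_{\pi}\prod_{p\in\pi}K_{|p|}(a_i: i\in p)$, the sum being over all set partitions $\pi$ of $\{1,\dots,n\}$. $\mathrm{Lab}(H)$ is the set of all labellings of the white vertices of $H$ by pairwise distinct elements of $\{1,\dots,N\}$ (it is empty if $H$ has more than $N$ white vertices). There is no restriction on the number of black vertices. $\mathrm{Aut}\,H$ is the group of graph automorphisms of the unlabelled graph $H$ sending black vertices to black vertices and white vertices to white vertices. $H^\bullet$ is the simple graph whose vertices are the black vertices of $H$, two distinct black vertices being joined by an edge if and only if they have at least one common white neighbour in $H$. For a finite simple loopless graph $G$ with vertex set $V$, $\mathcal P_G$ is the lattice of set partitions of $V$ all of whose parts induce connected subgraphs of $G$, ordered by $\pi\le\gamma$ if $\pi$ is finer than $\gamma$. Its minimal element $0_G$ is the partition into singletons and its maximal element $1_G$ is the partition into connected components. $\mu(G):=\mu(0_G,1_G)$ is the value of the Möbius function of $\mathcal P_G$; for connected $G$ it equals the coefficient of $z$ in the chromatic polynomial $\chi_G(z)$. For each monomial in $e_1,\dots,e_N$ only finitely many $H$ contribute, so the right-hand side is a well-defined formal power series in $e_1,\dots,e_N$, hence in $h_1,\dots,h_N$. *)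

(* Defs.v *)
From HB Require Import structures.
From mathcomp Require Import all_boot all_order all_algebra all_fingroup.
From mathcomp Require Import generic_quotient.

Set Implicit Arguments.
Unset Strict Implicit.
Unset Printing Implicit Defensive.

Import Order.TTheory GRing.Theory Num.Theory.
Local Open Scope ring_scope.

(** * Joint cumulants *)

Section CumulantsOf.
Variables (I : finType) (R : comNzRingType) (mom : {set I} -> R).
Implicit Types S A : {set I}.

Fixpoint cumulant_rec (n : nat) S : R :=
  if n is n'.+1 then
    mom S - \sum_(p : {set {set I}} | partition p S && (p != [set S]))
              \prod_(A in p) cumulant_rec n' A
  else 0.

(* The moment-cumulant formula (lemma [moment_cumulants_of]) solved recursively
   for its one-block term; a block of any other partition of [S] is strictly
   smaller than [S], so [#|S|] is enough fuel. *)
Definition cumulants_of S : R := cumulant_rec #|S| S.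

Lemma partition_block_card (p : {set {set I}}) S A : partition p S ->
  p != [set S] -> A \in p -> (#|A| < #|S|)%N.
Proof.
move=> pS pn Ap; apply: proper_card; rewrite properEneq; apply/andP; split.
  apply: contraNneq pn => AS; subst A.
  rewrite eqEsubset sub1set Ap andbT; apply/subsetP => B Bp; rewrite inE.
  apply/eqP; apply: contraNeq (partition_neq0 pS Bp) => BS.
  have /trivIsetP/(_ _ _ Bp Ap BS) := partition_trivIset pS.
  rewrite -setI_eq0 => /eqP BSI; rewrite -BSI; apply/eqP/esym/setIidPl.
  exact: partitionS pS Bp.
exact: partitionS pS Ap.
Qed.

Lemma cumulant_recE n S : (#|S| <= n)%N -> S != set0 ->
  cumulant_rec n S = cumulants_of S.
Proof.
rewrite /cumulants_of; have [k] := ubnP #|S|; elim: k n S => // k IHk n S Sk Sn S0.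
move: Sk Sn; case ES: #|S| => [|s]; first by rewrite (cards0_eq ES) eqxx in S0.
case: n => // n Sk Sn /=; congr (_ - _); apply: eq_bigr => p /andP[pS pn].
apply: eq_bigr => A Ap.
have As := partition_block_card pS pn Ap; rewrite ES ltnS in As.
have A0 := partition_neq0 pS Ap.
have Ak : (#|A| < k)%N by exact: leq_ltn_trans As Sk.
by rewrite [LHS]IHk ?[RHS]IHk // (leq_trans As).
Qed.

Lemma moment_cumulants_of S : mom set0 = 1 ->
  mom S = \sum_(p : {set {set I}} | partition p S)
                     \prod_(A in p) cumulants_of A.
Proof.
move=> mom0; have [->|S0] := eqVneq S set0.
  under eq_bigl do rewrite partition_set0.
  by rewrite big_pred1_eq big_set0.
have SS : partition [set S] S.
  apply/and3P; split; rewrite ?cover1 ?trivIset1 //.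
  by rewrite inE eq_sym.
rewrite (bigD1 [set S]) //= big_set1 {1}/cumulants_of.
case ES: #|S| => [|s] /=; first by rewrite (cards0_eq ES) eqxx in S0.
rewrite -[LHS](subrK (\sum_(p | partition p S && (p != [set S]))
   \prod_(A in p) cumulants_of A)); congr (_ + _); congr (_ - _).
apply: eq_bigr => p /andP[pS pn]; apply: eq_bigr => A Ap.
rewrite cumulant_recE ?(partition_neq0 pS) // -ltnS -ES.
exact: partition_block_card pS pn Ap.
Qed.

End CumulantsOf.

(** * The Moebius function of a finite graph *)

Section Mobius.
Context {disp : Order.disp_t} {T : finPOrderType disp}.
Implicit Types x y z : T.

Fixpoint mobius_rec (n : nat) x y : int :=
  if x == y then 1 else
  if n is n'.+1 then - \sum_(z : T | (x <= z < y)%O) mobius_rec n' x z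
  else 0.

(* The recursion goes down strictly decreasing chains, so [#|T|] is enough fuel;
   see [mobiusE]. *)
Definition mobius x y : int := mobius_rec #|T| x y.

Lemma mobius_recE n x y : (#|[set z : T | (x <= z < y)%O]| <= n)%N ->
  mobius_rec n x y = mobius x y.
Proof.
rewrite /mobius.
suff H k m y' : (#|[set z : T | (x <= z < y')%O]| <= k)%N ->
    (#|[set z : T | (x <= z < y')%O]| <= m)%N ->
    mobius_rec k x y' = mobius_rec m x y'.
  by move=> yn; apply: H => //; exact: max_card.
elim: k m y' => [|k IHk] [|m] {}y /=; case: eqP => // _.
- rewrite leqn0 cards_eq0 => /eqP y0 _; rewrite big1 ?oppr0 // => z xzy.
  by have := in_set0 z; rewrite -y0 inE xzy.
- move=> _; rewrite leqn0 cards_eq0 => /eqP y0; rewrite big1 ?oppr0 // => z xzy.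
  by have := in_set0 z; rewrite -y0 inE xzy.
move=> yk ym; congr (- _); apply: eq_bigr => z /andP[xz zy].
have zy_lt : (#|[set u : T | (x <= u < z)%O]| < #|[set u : T | (x <= u < y)%O]|)%N.
  apply/proper_card/properP; split.
    by apply/subsetP => u; rewrite !inE => /andP[-> uz]; exact: lt_trans zy.
  by exists z; rewrite !inE ?xz ?zy // ltxx andbF.
by apply: IHk; rewrite -ltnS (leq_trans zy_lt).
Qed.

Lemma mobius_id x : mobius x x = 1.
Proof. by rewrite /mobius; case: #|T| => /= [|n]; rewrite eqxx. Qed.

Lemma mobiusE x y : (x < y)%O ->
  mobius x y = - \sum_(z : T | (x <= z < y)%O) mobius x z.
Proof.
have fuel : (#|[set z : T | (x <= z < y)%O]| <= #|T|.+1)%N.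
  exact: leq_trans (max_card _) (leqnSn _).
move=> xy; rewrite -(mobius_recE fuel) /= (lt_eqF xy); congr (- _).
Qed.

End Mobius.

Record sgraph (V : finType) := SGraph {
  sgraph_edge :> rel V;
  sgraph_sym : symmetric sgraph_edge;
  sgraph_irr : irreflexive sgraph_edge }.

Section BondLattice.
Variables (V : finType) (G : sgraph V).
Implicit Types (A B : {set V}).

Definition induces_connected A : bool :=
  [forall x in A, forall y in A,
     connect [rel u v | [&& u \in A, v \in A & G u v]] x y].

Record bond_partition := BondPartition {
  bp_parts :> {set {set V}};
  bp_parts_valid : partition bp_parts [set: V] &&
                   [forall A in bp_parts, induces_connected A] }.

HB.instance Definition _ := [isSub for bp_parts].
HB.instance Definition _ := [Finite of bond_partition by <:].
Implicit Types p q : bond_partition.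

Definition finer p q : bool :=
  [forall A in (p : {set {set V}}), exists B in (q : {set {set V}}), A \subset B].

Lemma finerP p q :
  reflect (forall A, A \in bp_parts p -> exists2 B, B \in bp_parts q & A \subset B)
          (finer p q).
Proof.
apply: (iffP forall_inP) => pq A Ap; first by have /exists_inP := pq A Ap.
by apply/exists_inP; exact: pq.
Qed.

Lemma bp_partition p : partition p [set: V].
Proof. by case/andP: (bp_parts_valid p). Qed.

Lemma finer_refl : reflexive finer.
Proof. by move=> p; apply/finerP => A Ap; exists A. Qed.

Lemma finer_trans : transitive finer.
Proof.
move=> q p r /finerP pq /finerP qr; apply/finerP => A /pq[B /qr[C Cr BC] AB].
by exists C => //; exact: subset_trans BC.
Qed.

Let finer_sub p q : finer p q -> finer q p -> bp_parts p \subset bp_parts q.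
Proof.
move=> /finerP pq /finerP qp; apply/subsetP => A Ap.
have [B Bq AB] := pq A Ap; have [C Cp BC] := qp B Bq.
suff eqAC : A = C.
  by rewrite (_ : A = B) //; apply/eqP; rewrite eqEsubset AB eqAC.
apply/eqP; apply: contraNT (partition_neq0 (bp_partition p) Ap) => neAC.
have /trivIsetP/(_ _ _ Ap Cp neAC) := partition_trivIset (bp_partition p).
rewrite -setI_eq0 => /eqP <-; apply/eqP/esym/setIidPl.
exact: subset_trans BC.
Qed.

Lemma finer_anti : antisymmetric finer.
Proof.
move=> p q /andP[pq qp]; apply: val_inj; apply/eqP.
by rewrite eqEsubset !finer_sub.
Qed.

HB.instance Definition _ := Order.Le_isPOrder.Build (Order.Disp tt tt) bond_partition
  finer_refl finer_anti finer_trans.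

Definition singleton_parts : {set {set V}} := [set [set x] | x : V].
Definition component_parts : {set {set V}} :=
  [set [set y | connect G x y] | x : V].

Lemma singleton_parts_valid : partition singleton_parts [set: V] &&
  [forall A in singleton_parts, induces_connected A].
Proof.
apply/andP; split; last first.
  apply/forall_inP => _ /imsetP[x _ ->]; apply/forall_inP => u /set1P->.
  by apply/forall_inP => v /set1P->.
apply/and3P; split.
- rewrite eqEsubset subsetT; apply/subsetP => x _; apply/bigcupP.
  by exists [set x]; rewrite ?set11 // imset_f.
- apply/trivIsetP => _ _ /imsetP[x _ ->] /imsetP[y _ ->] xy.
  by rewrite disjoints1 inE; apply: contraNneq xy => ->.
- by apply/imsetP => -[x _ /setP/(_ x)]; rewrite !inE eqxx.
Qed.

Lemma component_parts_valid : partition component_parts [set: V] &&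
  [forall A in component_parts, induces_connected A].
Proof.
have Gsym : connect_sym G by exact: sym_connect_sym (sgraph_sym G).
apply/andP; split.
  apply/and3P; split.
  - rewrite eqEsubset subsetT; apply/subsetP => x _; apply/bigcupP.
    by exists [set y | connect G x y]; rewrite ?inE // imset_f.
  - apply/trivIsetP => _ _ /imsetP[x _ ->] /imsetP[y _ ->] xy.
    apply/pred0P => z /=; rewrite !inE; apply: contraNF xy => /andP[xz yz].
    apply/eqP/setP => u; rewrite !inE.
    by rewrite (same_connect Gsym xz) (same_connect Gsym yz).
  - apply/imsetP => -[x _ /setP/(_ x)]; rewrite !inE; move/esym.
    by rewrite connect0.
apply/forall_inP => _ /imsetP[x _ ->]; apply/forall_inP => u; rewrite inE => xu.
apply/forall_inP => v; rewrite inE => xv.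
have : connect G u v by apply: connect_trans xv; rewrite Gsym.
case/connectP => s; elim: s u xu {xv} => [|w s IHs] u xu /= => [_ ->//|].
case/andP => uw ws vs.
have xw : connect G x w by apply: connect_trans xu (connect1 _).
apply: connect_trans (IHs w xw ws vs).
by apply: connect1; rewrite /= !inE xu xw.
Qed.

Definition bond0 := BondPartition singleton_parts_valid.
Definition bond1 := BondPartition component_parts_valid.

Lemma bond0_le p : (bond0 <= p)%O.
Proof.
apply/finerP => _ /imsetP[x _ ->].
have : x \in cover p by rewrite (cover_partition (bp_partition p)) inE.
by case/bigcupP => A Ap xA; exists A; rewrite ?sub1set.
Qed.

Lemma le_bond1 p : (p <= bond1)%O.
Proof.
apply/finerP => A Ap.
have /set0Pn[x xA] := partition_neq0 (bp_partition p) Ap.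
exists [set y | connect G x y]; first exact: imset_f.
apply/subsetP => y yA; rewrite inE.
case/andP: (bp_parts_valid p) => _ /forall_inP/(_ A Ap).
move=> /forall_inP/(_ x xA)/forall_inP/(_ y yA).
by apply: connect_sub => u v /= /and3P[_ _ /connect1].
Qed.

HB.instance Definition _ := Order.hasBottom.Build _ bond_partition bond0_le.
HB.instance Definition _ := Order.hasTop.Build _ bond_partition le_bond1.

Definition graph_mobius : int := mobius (\bot%O : bond_partition) \top%O.

End BondLattice.

(** * Bipartite graphs *)

(* A bipartite graph with black vertices ['I_nblack], white vertices
   ['I_nwhite], and edges given as (black, white) pairs. *)
Record bigraph := Bigraph {
  nblack : nat;
  nwhite : nat;
  edges : {set 'I_nblack * 'I_nwhite} }.

Definition bigraph_tag (H : bigraph) :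
    {n : nat * nat & {set 'I_n.1 * 'I_n.2}} :=
  @Tagged _ (nblack H, nwhite H) (fun n => {set 'I_n.1 * 'I_n.2}) (edges H).

Definition bigraph_untag (x : {n : nat * nat & {set 'I_n.1 * 'I_n.2}}) :=
  Bigraph (tagged x).

Lemma bigraph_tagK : cancel bigraph_tag bigraph_untag.
Proof. by case. Qed.

HB.instance Definition _ := Choice.copy bigraph (can_type bigraph_tagK).

Section Bigraph.
Variable H : bigraph.

Definition bvertex : finType := ('I_(nblack H) + 'I_(nwhite H))%type.

Definition is_black (v : bvertex) : bool := if v is inl _ then true else false.

Definition badj : rel bvertex := fun u v =>
  match u, v with
  | inl x, inr y | inr y, inl x => (x, y) \in edges H
  | _, _ => false
  end.

Definition bigraph_connected : bool := [forall u, forall v, connect badj u v].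

Definition white_nbrs (x : 'I_(nblack H)) : {set 'I_(nwhite H)} :=
  [set y | (x, y) \in edges H].

Definition black_rel : rel 'I_(nblack H) :=
  [rel x y | (x != y) && (white_nbrs x :&: white_nbrs y != set0)].

Lemma black_rel_sym : symmetric black_rel.
Proof. by move=> x y; rewrite /black_rel /= eq_sym setIC. Qed.

Lemma black_rel_irr : irreflexive black_rel.
Proof. by move=> x; rewrite /black_rel /= eqxx. Qed.

Definition black_graph := SGraph black_rel_sym black_rel_irr.

End Bigraph.


From mathcomp Require Import all_classical all_reals all_analysis.
Local Open Scope classical_set_scope.

(** * Formal power series in [N] commuting variables *)

(* The exponent [m] stands for the monomial \prod_i h_i ^ (m i). *)
Notation expo N := {ffun 'I_N -> nat}.

Definition expo_deg N (m : expo N) : nat := (\sum_(i < N) m i)%N.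

Record fps (N : nat) (R : Type) := FPS { fps_coef :> expo N -> R }.

Lemma fpsP N R (f g : fps N R) : (forall m, f m = g m) <-> f = g.
Proof.
by split=> [|->//]; case: f g => [f] [g] /= fg; congr FPS; apply/funext.
Qed.

HB.instance Definition _ N (R : Type) := gen_eqMixin (fps N R).
HB.instance Definition _ N (R : Type) := gen_choiceMixin (fps N R).

Section FpsRing.
Variables (N : nat) (R : comNzRingType).
Implicit Types (f g k : fps N R) (m a b c : expo N).

Definition fps_zero : fps N R := FPS (fun=> 0).
Definition fps_opp f : fps N R := FPS (fun m => - f m).
Definition fps_add f g : fps N R := FPS (fun m => f m + g m).
Definition fps_one : fps N R := FPS (fun m => (m == 0)%:R).
Definition fps_mul f g : fps N R :=
  FPS (fun m => \sum_(p \in [set p : expo N * expo N | p.1 + p.2 = m])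
         f p.1 * g p.2).
Definition fps_scale (x : R) f : fps N R := FPS (fun m => x * f m).

Let addA : associative fps_add.
Proof. by move=> f g k; apply/fpsP => m /=; rewrite addrA. Qed.
Let addC : commutative fps_add.
Proof. by move=> f g; apply/fpsP => m /=; rewrite addrC. Qed.
Let add0 : left_id fps_zero fps_add.
Proof. by move=> f; apply/fpsP => m /=; rewrite add0r. Qed.
Let addN : left_inverse fps_zero fps_opp fps_add.
Proof. by move=> f; apply/fpsP => m /=; rewrite addNr. Qed.

HB.instance Definition _ := GRing.isZmodule.Build (fps N R) addA addC add0 addN.

Definition expo_below m : seq (expo N) :=
  [seq [ffun i => val (x i)] | x : {ffun 'I_N -> 'I_(expo_deg m).+1}].

Lemma expo_below_uniq m : uniq (expo_below m).
Proof.
rewrite map_inj_uniq ?enum_uniq // => x y /ffunP xy.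
by apply/ffunP => i; have := xy i; rewrite !ffunE => /val_inj.
Qed.

Lemma expo_leq_deg m (i : 'I_N) : (m i <= expo_deg m)%N.
Proof. by rewrite /expo_deg (bigD1 i) //= leq_addr. Qed.

Lemma mem_expo_below m a : (forall i, (a i <= m i)%N) -> a \in expo_below m.
Proof.
move=> am; apply/mapP; exists [ffun i => inord (a i)]; rewrite ?mem_enum //.
apply/ffunP => i; rewrite !ffunE /= inordK //.
by rewrite ltnS (leq_trans (am i)) ?expo_leq_deg.
Qed.

Lemma fps_mul_seq (s : seq (expo N)) f g m : uniq s ->
    (forall a b, a + b = m -> (a \in s) && (b \in s)) ->
  fps_mul f g m = \sum_(a <- s) \sum_(b <- s) if a + b == m then f a * g b else 0.
Proof.
move=> us sm.
pose r := [seq p <- [seq (a, b) | a <- s, b <- s] | p.1 + p.2 == m].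
rewrite /fps_mul /= (@fsbigE _ _ _ _ _ r).
- rewrite big_filter_cond big_mkcond big_allpairs /=.
  apply: eq_bigr => a _; apply: eq_bigr => b _.
  by case: eqP => //= ab; rewrite mem_set.
- by rewrite filter_uniq // allpairs_uniq // => -[? ?] [? ?].
- by move=> p /=; rewrite mem_filter => /andP[/eqP].
- move=> [a b] /= [abm pr]; case: pr.
  by rewrite /= mem_filter /= abm eqxx /=; case/andP: (sm _ _ abm) => ? ?;
     rewrite allpairs_f.
Qed.

Lemma expo_belowP m d x a b : d + x = m -> a + b = d ->
  (a \in expo_below m) && (b \in expo_below m).
Proof.
move=> <- <-; rewrite !mem_expo_below // => i; rewrite !ffunE.
  exact: leq_trans (leq_addl (a i) (b i)) (leq_addr _ _).
exact: leq_trans (leq_addr (b i) (a i)) (leq_addr _ _).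
Qed.

Lemma fps_mulE m d x f g (s := expo_below m) : d + x = m ->
  fps_mul f g d = \sum_(a <- s) \sum_(b <- s) if a + b == d then f a * g b else 0.
Proof.
move=> dx; apply: fps_mul_seq (expo_below_uniq m) _ => a b.
exact: expo_belowP dx.
Qed.

Let mulC : commutative fps_mul.
Proof.
move=> f g; apply/fpsP => m; rewrite !(@fps_mulE m m 0) ?addr0 //.
rewrite exchange_big /=; apply: eq_bigr => a _.
by apply: eq_bigr => b _; rewrite addrC mulrC.
Qed.

Let mulA : associative fps_mul.
Proof.
move=> f g k; apply/fpsP => m.
have mulE f' g' k' : fps_mul (fps_mul f' g') k' m =
    \sum_(a <- expo_below m) \sum_(b <- expo_below m) \sum_(c <- expo_below m)
      if a + b + c == m then f' a * g' b * k' c else 0.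
  rewrite (@fps_mulE m m 0) ?addr0 //; set s := expo_below m.
  transitivity (\sum_(d <- s) \sum_(c <- s) \sum_(a <- s) \sum_(b <- s)
      if (d + c == m) && (a + b == d) then f' a * g' b * k' c else 0).
    apply: eq_bigr => d _; apply: eq_bigr => c _; case: eqP => [dc|_] /=; last first.
      by rewrite big1 // => a _; rewrite big1.
    rewrite -[X in X * _]/(fps_mul f' g' d) (fps_mulE _ _ dc) mulr_suml; apply: eq_bigr => a _.
    rewrite mulr_suml; apply: eq_bigr => b _.
    by case: eqP; rewrite ?mul0r.
  rewrite exchange_big /=.
  under eq_bigr do rewrite exchange_big /=.
  rewrite exchange_big /=; apply: eq_bigr => a _.
  under eq_bigr do rewrite exchange_big /=.
  rewrite exchange_big /=; apply: eq_bigr => b _; apply: eq_bigr => c _.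
  case: eqP => [abc|nabc]; last first.
    rewrite big1 // => d _; case: eqP => //= dc; case: eqP => // ab.
    by case: nabc; rewrite ab.
  have abs : a + b \in s by case/andP: (@expo_belowP m m 0 _ _ (addr0 _) abc).
  rewrite (bigD1_seq (a + b)) ?expo_below_uniq //= abc !eqxx /=.
  rewrite big1 ?addr0 // => d dab.
  by rewrite [a + b == d]eq_sym (negPf dab) andbF.
rewrite [fps_mul f _]mulC !mulE; under eq_bigr do rewrite exchange_big /=.
rewrite exchange_big /=; apply: eq_bigr => c _; apply: eq_bigr => a _.
by apply: eq_bigr => b _; rewrite [c + a]addrC addrAC mulrAC [g a * _]mulrC.
Qed.

Let mul1 : left_id fps_one fps_mul.
Proof.
move=> f; apply/fpsP => m; rewrite (@fps_mulE m m 0) ?addr0 //.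
have m0 : 0 \in expo_below m by apply: mem_expo_below => i; rewrite ffunE.
have mm : m \in expo_below m by apply: mem_expo_below.
rewrite (bigD1_seq 0) ?expo_below_uniq //=.
rewrite [X in _ + X]big1 ?addr0 => [|a /negPf a0]; last first.
  by rewrite big1 // => b _; rewrite /= a0 mul0r if_same.
rewrite (bigD1_seq m) ?expo_below_uniq //= add0r !eqxx mul1r.
by rewrite big1 ?addr0 // => b /negPf bm; rewrite add0r bm.
Qed.

Let mulDl : left_distributive fps_mul fps_add.
Proof.
move=> f g k; apply/fpsP => m.
suff : fps_mul (fps_add f g) k m = fps_mul f k m + fps_mul g k m by [].
rewrite !(@fps_mulE m m 0) ?addr0 //.
rewrite -big_split; apply: eq_bigr => a _ /=.
rewrite -big_split; apply: eq_bigr => b _ /=.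
by case: ifP; rewrite ?addr0 // mulrDl.
Qed.

Let one_neq0 : fps_one != 0.
Proof.
by apply/eqP => /fpsP /(_ 0) /eqP; rewrite /= eqxx oner_eq0.
Qed.

HB.instance Definition _ := GRing.Zmodule_isComNzRing.Build (fps N R)
  mulA mulC mul1 mulDl one_neq0.

Let scaleA (x y : R) f : fps_scale x (fps_scale y f) = fps_scale (x * y) f.
Proof. by apply/fpsP => m /=; rewrite mulrA. Qed.
Let scale1 : left_id 1 fps_scale.
Proof. by move=> f; apply/fpsP => m /=; rewrite mul1r. Qed.
Let scaleDr : right_distributive fps_scale +%R.
Proof. by move=> x f g; apply/fpsP => m /=; rewrite mulrDr. Qed.
Let scaleDl f : {morph fps_scale^~ f : x y / x + y}.
Proof. by move=> x y; apply/fpsP => m /=; rewrite mulrDl. Qed.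

HB.instance Definition _ := GRing.Zmodule_isLmodule.Build R (fps N R)
  scaleA scale1 scaleDr scaleDl.

Let scaleAl (x : R) f g : x *: (f * g) = x *: f * g.
Proof.
apply/fpsP => m.
suff : x * fps_mul f g m = fps_mul (fps_scale x f) g m by [].
rewrite !(@fps_mulE m m 0) ?addr0 //.
rewrite mulr_sumr; apply: eq_bigr => a _; rewrite mulr_sumr.
by apply: eq_bigr => b _; case: ifP => _; rewrite ?mulr0 //= mulrA.
Qed.

HB.instance Definition _ := GRing.Lmodule_isLalgebra.Build R (fps N R) scaleAl.

Lemma fps_exprn_eq0 f n m : f 0 = 0 -> (expo_deg m < n)%N -> (f ^+ n) m = 0.
Proof.
move=> f0; elim: n m => [//|n IHn] m mn.
rewrite exprS; suff : fps_mul f (f ^+ n) m = 0 by [].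
rewrite (@fps_mulE m m 0) ?addr0 //.
rewrite big1 // => a _; rewrite big1 // => b _; case: eqP => // abm.
have [->|a0] := eqVneq a 0; first by rewrite f0 mul0r.
rewrite IHn ?mulr0 // -ltnS (leq_trans _ mn) // ltnS -abm.
have [i ai] : exists i, a i != 0%N.
  apply/existsP; apply: contraNT a0 => /existsPn a0; apply/eqP/ffunP => i.
  by rewrite ffunE; apply/eqP; have := a0 i; rewrite negbK.
rewrite /expo_deg; under [ltnRHS]eq_bigr do rewrite ffunE.
rewrite big_split /= [X in (_ < X + _)%N](bigD1 i) //=.
by rewrite -[ltnLHS]add0n ltn_add2r addn_gt0 lt0n ai.
Qed.

End FpsRing.

Section FpsSeries.
Variables (N : nat) (R : fieldType).
Implicit Types (f : fps N R) (m : expo N).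

Definition fps_var (i : 'I_N) : fps N R :=
  FPS (fun m => (m == [ffun j => (j == i : nat)])%:R).

Definition fps_summable (I : choiceType) (D : set I) (F : I -> fps N R) :=
  forall m, finite_set [set i | D i /\ F i m != 0].

(* Coefficientwise sum of a family of series; only meaningful for a summable
   family, since [\sum_(i \in D)] is 0 on an infinite support. *)
Definition fps_sum (I : choiceType) (D : set I) (F : I -> fps N R) : fps N R :=
  FPS (fun m => \sum_(i \in D) F i m).

Definition fps_exp_term f (n : nat) : fps N R := n`!%:R^-1 *: f ^+ n.

(* Only for [f] with zero constant term. *)
Definition fps_exp f : fps N R := fps_sum [set: nat] (fps_exp_term f).

Definition fps_log_term f (n : nat) : fps N R :=
  ((-1) ^+ n.-1 / n%:R) *: (f - 1) ^+ n.

(* Only for [f] with constant term 1. *)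
Definition fps_log f : fps N R := fps_sum [set n | (0 < n)%N] (fps_log_term f).

Lemma fps_powers_summable (D : set nat) (c : nat -> R) f : f 0 = 0 ->
  fps_summable D (fun n => c n *: f ^+ n).
Proof.
move=> f0 m; apply: (@sub_finite_set _ _ `I_(expo_deg m).+1) => [n [_]|].
  apply: contraNT; rewrite -leqNgt => mn /=.
  by rewrite fps_exprn_eq0 ?mulr0.
exact: finite_II.
Qed.

Lemma fps_exp_summable f : f 0 = 0 -> fps_summable setT (fps_exp_term f).
Proof. exact: fps_powers_summable. Qed.

Lemma fps_log_summable f : f 0 = 1 ->
  fps_summable [set n | (0 < n)%N] (fps_log_term f).
Proof.
move=> f1; apply: fps_powers_summable.
by rewrite -[LHS]/(f 0 - (0 == 0 :> expo N)%:R) eqxx f1 subrr.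
Qed.

End FpsSeries.

Section Cumulant.
Context d (T : measurableType d) (R : realType) (P : probability T R).

(* Coefficientwise expectation of a random formal power series. *)
Definition fps_expectation N (F : T -> fps N R) : fps N R :=
  FPS (fun m => fine 'E_P[fun t => F t m]%E).

Variables (I : finType) (a : I -> {RV P >-> R}).

Definition joint_moment (S : {set I}) : R :=
  fine 'E_P[fun t => (\prod_(i in S) a i t)%R]%E.

(* K_{|S|}(a_i : i in S), for random variables having all joint moments *)
Definition cumulant (S : {set I}) : R := cumulants_of joint_moment S.

Lemma moment_cumulant (S : {set I}) :
  joint_moment S = \sum_(p : {set {set I}} | finset.partition p S)
                     \prod_(A in p) cumulant A.
Proof.
apply: moment_cumulants_of; rewrite /joint_moment.
under [X in 'E_P[X]%E]eq_fun do rewrite big_set0.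
by rewrite expectation_cst.
Qed.

End Cumulant.

Definition is_bigraph_iso (H K : bigraph) (f : bvertex H -> bvertex K) : Prop :=
  [/\ bijective f,
      forall v, is_black (f v) = is_black v &
      forall u v, badj (f u) (f v) = badj u v].

Definition bigraph_Aut (H : bigraph) : {set {perm bvertex H}} :=
  [set s : {perm bvertex H} | `[< is_bigraph_iso s >]]%SET.

Definition bigraph_iso (H K : bigraph) : bool :=
  `[< exists f, @is_bigraph_iso H K f >].

Lemma bigraph_iso_refl : reflexive bigraph_iso.
Proof. by move=> H; apply/asboolP; exists id; split=> //; exists id. Qed.

Lemma bigraph_iso_sym : symmetric bigraph_iso.
Proof.
suff S H K : bigraph_iso H K -> bigraph_iso K H.
  by move=> H K; apply/idP/idP; exact: S.
move=> /asboolP[f [[g fK gK] fc fe]]; apply/asboolP; exists g; split.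
- by exists f.
- by move=> v; rewrite -fc gK.
- by move=> u v; rewrite -fe !gK.
Qed.

Lemma bigraph_iso_trans : transitive bigraph_iso.
Proof.
move=> K H L /asboolP[f [fb fc fe]] /asboolP[g [gb gc ge]].
apply/asboolP; exists (g \o f); split; first exact: bij_comp.
  by move=> v /=; rewrite gc fc.
by move=> u v /=; rewrite ge fe.
Qed.

Definition bigraph_equiv :=
  EquivRel bigraph_iso bigraph_iso_refl bigraph_iso_sym bigraph_iso_trans.

Local Open Scope quotient_scope.
(* Isomorphism classes; every bipartite graph has a copy of the form [bigraph]. *)
Notation bigraph_class := {eq_quot bigraph_equiv}.

Definition connected_bigraph_classes : set bigraph_class :=
  [set C | bigraph_connected (repr C) /\
           (2 <= nblack (repr C) + nwhite (repr C))%N].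

Section Weight.
Context d (T : measurableType d) (R : realType) (P : probability T R).
Variables (N : nat) (b : 'I_N -> {RV P >-> R}).

(* e_i = e^{h_i} - 1 *)
Definition fps_e (i : 'I_N) : fps N R := fps_exp (fps_var R i) - 1.

Definition labelling_weight (H : bigraph) (L : {ffun 'I_(nwhite H) -> 'I_N}) :
    fps N R :=
  (\prod_(x : 'I_(nblack H)) cumulant (fun y => b (L y)) (white_nbrs x)) *:
  \prod_(xy in edges H) fps_e (L xy.2).

(* The sum over Lab(H) is the sum over injective [L]. *)
Definition bigraph_term (H : bigraph) : fps N R :=
  ((graph_mobius (black_graph H))%:~R / #|bigraph_Aut H|%:R) *:
  \sum_(L : {ffun 'I_(nwhite H) -> 'I_N} | injectiveb L) labelling_weight L.

End Weight.

(* Main.v *)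
Require Import Defs.
From mathcomp Require Import all_boot all_order all_algebra all_fingroup.
From mathcomp Require Import generic_quotient.
From mathcomp Require Import boolp.

(* Since b_i is 0 or 1, e^{h_i b_i} = 1 + b_i e_i, so E[e^{sum_i h_i b_i}] is the
   sum over sets S of labels of E[prod_S b_i] prod_S e_i.  The moment-cumulant
   formula turns it into the sum over families of pairwise disjoint nonempty sets
   A of the product of the weights z(A) = K(b_i : i in A) prod_A e_i: the
   partition function of a gas of polymers A with hard-core repulsion.  Its
   logarithm is the Mayer expansion, the sum over n-tuples of polymers of
   1/n! times the product of their weights times the Ursell function of the graph
   recording which polymers of the tuple meet.

   The Ursell function of a graph is the "cumulant" of the indicator function of
   independent sets of vertices.  It vanishes on disconnected graphs, for the same
   reason that cumulants of independent variables do, and inverting the resulting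
   sum over the bond lattice identifies it with the Moebius function on connected
   graphs.  A tuple of polymers is a bipartite graph H with its black vertices
   numbered and its white vertices labelled; each tuple arises |Aut H| times from
   a numbering and a labelling of H, which converts the sum over tuples into the
   sum over isomorphism classes. *)

Set Implicit Arguments.
Unset Strict Implicit.
Unset Printing Implicit Defensive.

Import Order.TTheory GRing.Theory Num.Theory.
Local Open Scope ring_scope.

(** * Cumulants *)

Section Pointed.
Variables (I : finType) (R : comNzRingType).
Implicit Types (mom : {set I} -> R) (S B C : {set I}).

(** Group the partitions of [S] by their block [B] through [x]; what remains is an arbitrary
    partition of [S :\: B]. Inductions on cumulants use this form instead of the sum over all
    partitions. *)
Lemma moment_cumulants_pointed mom S x : mom set0 = 1 -> x \in S ->
  mom S = \sum_(B : {set I} | (B \subset S) && (x \in B))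
            cumulants_of mom B * mom (S :\: B).
Proof.
move=> mom0 xS; rewrite (moment_cumulants_of S mom0).
rewrite (partition_big (fun p => pblock p x)
  (fun B => (B \subset S) && (x \in B))) /= => [|p pS]; last first.
  have xp : x \in cover p by rewrite (cover_partition pS).
  by rewrite mem_pblock xp andbT (partitionS pS) ?pblock_mem.
apply: eq_bigr => B /andP[BS xB]; rewrite (moment_cumulants_of (S :\: B) mom0) mulr_sumr.
have BU : B :|: (S :\: B) = S by rewrite -[X in X :|: _](setIidPr BS) setID.
have Bp' p' : partition p' (S :\: B) -> B \notin p'.
  move=> p'S; apply/negP => /(partitionS p'S)/subsetP/(_ x xB).
  by rewrite inE xB.
rewrite (reindex_onto (fun p' => B |: p') (fun p => p :\ B)) /=; last first.
  move=> p /andP[pS /eqP <-]; rewrite setD1K // pblock_mem //.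
  by rewrite (cover_partition pS).
apply: eq_big => p'.
  apply/idP/idP => [/andP[/andP[pS _] /eqP <-]|p'S].
    by apply: partitionD1 => //; rewrite setU11.
  have pS : partition (B |: p') S.
    rewrite -BU; apply: partitionU1 => //; first by apply/set0Pn; exists x.
    by rewrite disjoint_sym disjoints_subset setDE subsetIr.
  rewrite pS setU1K ?Bp' // eqxx andbT /=.
  by apply/eqP/def_pblock; rewrite ?setU11 // (partition_trivIset pS).
by case/andP=> /andP[pS _] /eqP p'B; rewrite big_setU1 //= -p'B !inE eqxx.
Qed.

Lemma cumulants_of0 mom : cumulants_of mom set0 = 0.
Proof. by rewrite /cumulants_of cards0. Qed.

Lemma cumulants_of_pointed mom S x : mom set0 = 1 -> x \in S ->
  cumulants_of mom S = mom S -
    \sum_(B : {set I} | (B \subset S) && (x \in B) && (B != S))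
      cumulants_of mom B * mom (S :\: B).
Proof.
move=> mom0 xS; rewrite (moment_cumulants_pointed mom0 xS) (bigD1 S) ?subxx //=.
by rewrite setDv mom0 mulr1 addrK.
Qed.

End Pointed.

(** Induction on [#|C|] by the pointed recursion. Moments are compared only inside [C], so that
    [ursell_imset] applies to relations agreeing only there. *)
Lemma cumulants_of_imset (I J : finType) (R : comNzRingType)
    (mom1 : {set I} -> R) (mom2 : {set J} -> R) (f : I -> J) (C : {set I}) :
  injective f -> mom1 set0 = 1 -> mom2 set0 = 1 ->
  (forall S : {set I}, S \subset C -> mom1 S = mom2 (f @: S)) ->
  cumulants_of mom1 C = cumulants_of mom2 (f @: C).
Proof.
move=> fI m1 m2.
have fK (B : {set I}) : f @^-1: (f @: B) = B.
  by apply/setP => z; rewrite inE mem_imset.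
have fD (A B : {set I}) : f @: (A :\: B) = f @: A :\: f @: B.
  apply/setP => y; apply/imsetP/setDP => [[z /setDP[zA zB] ->]|].
    by rewrite !mem_imset.
  case=> /imsetP[z zA ->]; rewrite mem_imset // => zB.
  by exists z => //; apply/setDP.
have [n] := ubnP #|C|.
elim: n C => // n IHn C Cn mom12.
have [->|/set0Pn[x xC]] := eqVneq C set0; first by rewrite imset0 !cumulants_of0.
rewrite (cumulants_of_pointed m1 xC) (@cumulants_of_pointed _ _ _ _ (f x)) //; last first.
  exact: imset_f.
rewrite mom12 //; congr (_ - _).
rewrite [RHS](reindex_onto (fun B : {set I} => f @: B)
  (fun B : {set J} => f @^-1: B)) /=; last first.
  move=> B /andP[/andP[/subsetP BC _] _]; apply/setP => y.
  apply/imsetP/idP => [[z]|yB]; first by rewrite inE => ? ->.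
  have /imsetP[z zC yz] := BC y yB; exists z => //.
  by rewrite inE -yz.
apply: eq_big => B.
  by rewrite sub_imset_pre !fK mem_imset // (inj_eq (imset_inj fI)) eqxx andbT.
case/andP=> /andP[BC xB] nBC.
have sBC : B \proper C by rewrite properEneq nBC.
rewrite mom12 ?subsetDl // fD.
congr (_ * _); apply: IHn => [|S SB].
  exact: leq_trans (proper_card sBC) _.
by rewrite mom12 // (subset_trans SB).
Qed.

(** * The Ursell function of a graph *)

Section Ursell.
Variables (R : comNzRingType) (V : finType).
Implicit Types (e : rel V) (S A B C : {set V}).

Definition independent e S : bool :=
  [forall x in S, forall y in S, ~~ e x y].

Lemma independentP e S :
  reflect {in S &, forall x y, ~~ e x y} (independent e S).
Proof.
apply: (iffP forall_inP) => [ind x y xS yS|ind x xS].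
  by have /forall_inP := ind x xS; apply.
by apply/forall_inP => y; apply: ind.
Qed.

Definition independence_indicator e S : R := (independent e S)%:R.

(** For symmetric loopless [e] and nonempty [S], this is the sum of (-1)^|E| over the edge sets E of
    the connected spanning subgraphs of the graph induced on [S]. *)
Definition ursell e S : R := cumulants_of (independence_indicator e) S.

Lemma independence_indicator0 e : independence_indicator e set0 = 1.
Proof.
rewrite /independence_indicator; suff -> : independent e set0 by [].
by apply/independentP => x; rewrite inE.
Qed.

(** The indicator factors over [S :&: A] and [S :\: A]. In the recursion at a point of [S :&: A],
    proper blocks not contained in [A] vanish by induction, and the blocks inside [A] already add up
    to the whole moment. *)
Lemma ursell_eq0 e S A : symmetric e -> S :&: A != set0 -> S :\: A != set0 ->
  {in S :&: A & S :\: A, forall x y, ~~ e x y} -> ursell e S = 0.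
Proof.
move=> es; have [n] := ubnP #|S|; elim: n S => // n IHn S Sn SA SdA ne.
have mom0 := independence_indicator0 e.
have momA C : C \subset S -> independence_indicator e C =
    independence_indicator e (C :&: A) * independence_indicator e (C :\: A).
  move=> /subsetP CS; rewrite /independence_indicator -natrM mulnb.
  congr (_%:R); congr (nat_of_bool _); apply/independentP/andP => [ind|[]].
    by split; apply/independentP => x y; rewrite !inE => /andP[? ?] /andP[? ?];
       apply: ind.
  move=> /independentP indI /independentP indD x y xC yC.
  have [xA|xA] := boolP (x \in A); have [yA|yA] := boolP (y \in A).
  - by apply: indI; rewrite inE ?xC ?yC.
  - by apply: ne; rewrite inE ?CS ?yA ?xA.
  - by rewrite es; apply: ne; rewrite inE ?CS ?yA ?xA.
  - by apply: indD; rewrite inE ?xC ?yC ?xA ?yA.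
have /set0Pn[x xSA] := SA; have /setIP[xS xA] := xSA.
rewrite /ursell (cumulants_of_pointed mom0 xS).
apply/eqP; rewrite subr_eq0; apply/eqP.
rewrite momA // [X in X * _](moment_cumulants_pointed mom0 xSA).
rewrite mulr_suml [RHS](bigID (fun B => B \subset A)) /=.
rewrite [X in _ = _ + X]big1 ?addr0; last first.
  move=> B /andP[/andP[/andP[BS xB] nBS] nBA].
  rewrite -/(ursell e B) IHn ?mul0r //.
  - have : B \proper S by rewrite properEneq nBS.
    by move/proper_card/leq_trans; apply.
  - by apply/set0Pn; exists x; rewrite inE xB.
  - by rewrite setD_eq0.
  - move=> u v; rewrite !inE => /andP[uB uA] /andP[vA vB].
    by apply: ne; rewrite !inE ?uA ?vA (subsetP BS).
apply: eq_big => B.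
  rewrite subsetI; case BA: (B \subset A); rewrite ?andbF //= !andbT.
  suff -> : B != S by rewrite andbT.
  by apply: contraNneq SdA => <-; rewrite setD_eq0.
case/andP; rewrite subsetI => /andP[BS BA] xB.
rewrite [in RHS]momA ?subsetDl // -mulrA; congr (_ * (_ * _)).
  by congr independence_indicator; apply/setP => y; rewrite !inE andbA.
congr independence_indicator; apply/setP => y; rewrite !inE.
case yB: (y \in B); rewrite //= (subsetP BA) //.
Qed.

End Ursell.

Lemma independent_imset (I J : finType) (e : rel I) (e' : rel J) (f : I -> J)
    (C : {set I}) : {in C &, forall i j, e i j = e' (f i) (f j)} ->
  independent e C = independent e' (f @: C).
Proof.
move=> ee; apply/independentP/independentP => ind.
  by move=> _ _ /imsetP[i iC ->] /imsetP[j jC ->]; rewrite -ee ?ind.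
by move=> i j iC jC; rewrite ee ?ind ?imset_f.
Qed.

Lemma ursell_imset (R : comNzRingType) (I J : finType) (e : rel I) (e' : rel J)
    (f : I -> J) (C : {set I}) :
  injective f -> {in C &, forall i j, e i j = e' (f i) (f j)} ->
  ursell R e C = ursell R e' (f @: C).
Proof.
move=> fI ee; apply: cumulants_of_imset => //; try exact: independence_indicator0.
move=> S /subsetP SC; congr (_%:R); congr (nat_of_bool _).
by apply: independent_imset => i j /SC iC /SC; apply: ee.
Qed.

(** * The Ursell function as Moebius function of the bond lattice *)

Section BondUrsell.
Variables (R : comNzRingType) (V : finType) (G : sgraph V).
Implicit Types (p q : bond_partition G) (A B C : {set V}).

Let pb p x := pblock (bp_parts p) x.
(* The edges of [G] inside the blocks of [p]: the Ursell function of this graph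
   vanishes off the connected subsets of the blocks of [p], so its
   moment-cumulant formula is a sum over the bond partitions finer than [p]. *)
Definition within p : rel V := fun x y => G x y && (pb p x == pb p y).

Let covp p x : x \in cover (bp_parts p).
Proof. by rewrite (cover_partition (bp_partition p)) inE. Qed.

Lemma within_sym p : symmetric (within p).
Proof. by move=> x y; rewrite /within (sgraph_sym G) eq_sym. Qed.

(** A block with two points is connected, hence contains an edge of [G]. *)
Lemma independent_within p : independent (within p) [set: V] = (p == \bot%O).
Proof.
apply/independentP/eqP => [ind|-> x y _ _]; last first.
  apply/negP => /andP[xy /eqP pxy].
  have pbx z : pb (\bot%O : bond_partition G) z = [set z].
    apply: def_pblock; rewrite ?inE //; last exact: imset_f.
    exact: partition_trivIset (bp_partition _).
  have : x \in pb (\bot%O : bond_partition G) y by rewrite -pxy pbx inE.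
  by rewrite pbx inE => /eqP exy; rewrite exy (sgraph_irr G) in xy.
apply: le_anti; rewrite le0x andbT; apply/finerP => A Ap.
have /set0Pn[x xA] := partition_neq0 (bp_partition p) Ap.
exists [set x]; first exact: imset_f.
apply/subsetP => y yA; rewrite inE.
case/andP: (bp_parts_valid p) => _ /forall_inP/(_ A Ap).
move=> /forall_inP/(_ x xA)/forall_inP/(_ y yA)/connectP[[|z s] /=].
  by move=> _ ->.
case/andP=> /and3P[xA' zA xz] _ _.
have pbA u : u \in A -> pb p u = A.
  by move=> uA; apply: def_pblock => //; apply: partition_trivIset (bp_partition p).
by have := ind x z; rewrite /within xz !pbA // eqxx /= !inE => /(_ isT isT).
Qed.

(** This is the equation characterising mu(0, p), with the product of the Ursell functions of the
    blocks in place of mu. *)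
Lemma sum_ursell_below p :
  \sum_(q : bond_partition G | (q <= p)%O) \prod_(B in bp_parts q) ursell R G B =
  (p == \bot%O)%:R.
Proof.
have := moment_cumulants_of [set: V] (independence_indicator0 R (within p)).
rewrite /independence_indicator independent_within => ->.
(* The partitions satisfying [good] are the bond partitions finer than [p]; every other one has a
   block that [within p] disconnects. *)
pose good (q : {set {set V}}) :=
  [forall A in q, induces_connected G A && [exists B in bp_parts p, A \subset B]].
rewrite [RHS](bigID good) /= [X in _ = _ + X]big1 ?addr0; last first.
  move=> q /andP[qT] /forall_inPn[C Cq]; rewrite negb_and => bad.
  suff C0 : ursell R (within p) C = 0.
    by rewrite (bigD1 C) //= -/(ursell _ _ _) C0 mul0r.
  have ws := @within_sym p.
  (* Either [C] is disconnected in [G] and is cut along the component of [x], or [C] lies in no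
     block of [p] and is cut along the block of [x]. *)
  case/orP: bad => [/forall_inPn[x xC /forall_inPn[y yC nxy]]|/exists_inPn nC].
    pose A := [set z | connect [rel u v | [&& u \in C, v \in C & G u v]] x z].
    apply: (@ursell_eq0 _ _ _ _ A) => //.
    - by apply/set0Pn; exists x; rewrite !inE xC connect0.
    - by apply/set0Pn; exists y; rewrite !inE yC andbT.
    - move=> u v; rewrite !inE => /andP[uC xu] /andP[xv vC].
      apply: contra xv => /andP[uv _]; apply: connect_trans xu _.
      by apply: connect1; rewrite /= uC vC.
  have /set0Pn[x xC] := partition_neq0 qT Cq.
  have xp : x \in pb p x by rewrite mem_pblock covp.
  apply: (@ursell_eq0 _ _ _ _ (pb p x)) => //.
  - by apply/set0Pn; exists x; rewrite inE xC.
  - by rewrite setD_eq0 nC // pblock_mem.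
  - move=> u v; rewrite !inE => /andP[uC xu] /andP[xv vC].
    apply: contra xv => /andP[_ /eqP uv]; rewrite /pb -(same_pblock _ xu).
      by rewrite -/(pb p u) uv mem_pblock.
    exact: partition_trivIset (bp_partition p).
rewrite [RHS](reindex_omap (@bp_parts V G) insub) /=; last first.
  move=> q /andP[qT /forall_inP qg]; case: insubP => [u _ <- //|/negP[]].
  by rewrite qT; apply/forall_inP => A /qg/andP[].
apply: eq_big => q.
  rewrite (bp_partition q) /= (_ : insub _ = Some q) ?eqxx ?andbT; last exact: valK.
  apply/finerP/forall_inP => [qp A Aq|gq A /gq/andP[_ /exists_inP[B ? ?]]];
    last by exists B.
  case/andP: (bp_parts_valid q) => _ /forall_inP/(_ A Aq) -> /=.
  by apply/exists_inP/qp.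
move=> /finerP qp; apply: eq_bigr => A /qp[B Bp /subsetP AB].
rewrite -[in RHS](imset_id A); apply: (@ursell_imset _ _ _ _ _ id) => //.
move=> x y /AB xB /AB yB; rewrite /within.
have pbB u : u \in B -> pb p u = B.
  by move=> uB; apply: def_pblock => //; apply: partition_trivIset (bp_partition p).
by rewrite !pbB // eqxx andbT.
Qed.

Lemma mobius_bot_ursell p :
  (mobius \bot%O p)%:~R = \prod_(B in bp_parts p) ursell R G B.
Proof.
have [n] := ubnP #|[set q : bond_partition G | (q < p)%O]|; elim: n p => // n IHn p pn.
have := sum_ursell_below p; rewrite (bigD1 p) //=.
have [-> |pb0] := eqVneq p \bot%O.
  rewrite [X in _ + X]big1 ?addr0 => [->|q /andP[qb qn]].
    by rewrite mobius_id.
  by move: qn; rewrite -lex0 qb.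
move/eqP; rewrite addr_eq0 => /eqP ->.
rewrite mobiusE ?lt0x // mulrNz; congr (- _).
rewrite raddf_sum /=; apply/esym/eq_big => [q|q qp].
  by rewrite le0x lt_neqAle andbC.
rewrite andbC -lt_neqAle in qp; rewrite IHn //.
apply: (@leq_trans #|[set r : bond_partition G | (r < p)%O]|) => //.
apply/proper_card/properP; split.
  by apply/subsetP => r; rewrite !inE => /lt_trans; apply.
by exists q; rewrite !inE ?ltxx.
Qed.

(** Connectedness makes the top partition the single block [V]. The point [x0] excludes the empty
    graph, whose Moebius value is 1 and Ursell function 0. *)
Lemma graph_mobius_ursell (x0 : V) : (forall x y, connect G x y) ->
  (graph_mobius G)%:~R = ursell R G [set: V].
Proof.
move=> Gc; rewrite mobius_bot_ursell.
suff -> : bp_parts (\top%O : bond_partition G) = [set [set: V]] by rewrite big_set1.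
apply/setP => A; rewrite inE /= /component_parts.
apply/imsetP/eqP => [[x _ ->]|->]; last exists x0 => //.
  by apply/setP => y; rewrite !inE Gc.
by apply/setP => y; rewrite !inE Gc.
Qed.

End BondUrsell.

(** * Polymer gases *)

Lemma big_ffun_split (R : Type) (idx : R) (op : Monoid.com_law idx)
    (I J K P : finType) (u : J -> I) (v : K -> I) (w : I -> J + K)
    (F : {ffun J -> P} -> {ffun K -> P} -> R) :
  cancel (fun s => match s with inl j => u j | inr k => v k end) w ->
  cancel w (fun s => match s with inl j => u j | inr k => v k end) ->
  \big[op/idx]_(A : {ffun I -> P}) F [ffun j => A (u j)] [ffun k => A (v k)] =
  \big[op/idx]_(A1 : {ffun J -> P}) \big[op/idx]_(A2 : {ffun K -> P}) F A1 A2.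
Proof.
move=> uvK wK; rewrite pair_bigA /=.
pose h (A : {ffun J -> P} * {ffun K -> P}) : {ffun I -> P} :=
  [ffun i => match w i with inl j => A.1 j | inr k => A.2 k end].
rewrite (reindex h) /=; last first.
  exists (fun A => ([ffun j => A (u j)], [ffun k => A (v k)])) => [[A1 A2] _|A _].
    by congr pair; apply/ffunP => j; rewrite !ffunE;
      [rewrite (uvK (inl j))|rewrite (uvK (inr j))].
  by apply/ffunP => i; rewrite ffunE -[in RHS](wK i); case: (w i) => j; rewrite ffunE.
apply: eq_bigr => -[A1 A2] _; congr F; apply/ffunP => j; rewrite !ffunE.
  by rewrite (uvK (inl j)).
by rewrite (uvK (inr j)).
Qed.

Lemma card_sets_containing n k :
  #|[set B : {set 'I_n.+1} | (ord0 \in B) && (#|B| == k.+1)]| = 'C(n, k).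
Proof.
have -> : [set B : {set 'I_n.+1} | (ord0 \in B) && (#|B| == k.+1)] =
    (fun B => ord0 |: B) @: [set B : {set 'I_n.+1} | B \subset [set~ ord0] & #|B| == k].
  apply/setP => B; rewrite inE; apply/andP/imsetP => [[B0 Bk]|[C]].
    exists (B :\ ord0); last by rewrite setD1K.
    by rewrite inE setDE subsetIr /=; move: Bk; rewrite (cardsD1 ord0) B0 -setDE.
  rewrite inE => /andP[C0 Ck] ->; split; first exact: setU11.
  by rewrite cardsU1 (eqP Ck); move: C0; rewrite subsetC sub1set inE => ->.
rewrite card_in_imset => [|B C]; first by rewrite cards_draws cardsC1 card_ord.
rewrite !inE !(subsetC _ [set ord0]) !sub1set !inE => /andP[B0 _] /andP[C0 _] BC.
by rewrite -(setU1K B0) BC setU1K.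
Qed.

Section PolymerGas.
Variables (R : comNzRingType) (P : finType) (inc : rel P) (z : P -> R).
Hypothesis inc_sym : symmetric inc.

(** The indices, not the polymers, must differ: the graph is loopless, yet a polymer that repeats
    and is related to itself by [inc] yields an edge. *)
Definition overlap (I : finType) (A : {ffun I -> P}) : rel I :=
  fun i j => (i != j) && inc (A i) (A j).

(** Divided by n!, the values at ['I_n] are the terms of the partition function for [gas_total], and
    of its Mayer expansion for [gas_connected]. *)
Definition gas_total (I : finType) : R :=
  \sum_(A : {ffun I -> P})
    independence_indicator R (overlap A) [set: I] * \prod_i z (A i).

Definition gas_connected (I : finType) : R :=
  \sum_(A : {ffun I -> P}) ursell R (overlap A) [set: I] * \prod_i z (A i).

Lemma overlap_sym (I : finType) (A : {ffun I -> P}) : symmetric (overlap A).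
Proof. by move=> i j; rewrite /overlap eq_sym inc_sym. Qed.

Lemma overlap_comp (I J : finType) (A : {ffun I -> P}) (f : J -> I) i j :
  injective f -> overlap [ffun j => A (f j)] i j = overlap A (f i) (f j).
Proof. by move=> fI; rewrite /overlap (inj_eq fI) !ffunE. Qed.

(** Apply the pointed recursion to each tuple. For fixed [B] a tuple is a pair of tuples, on [B] and
    on its complement, whose overlap graphs are restrictions of the given one, so the sum
    factors. *)
Lemma gas_total_pointed (I : finType) (x : I) :
  gas_total I = \sum_(B : {set I} | x \in B)
                  gas_connected 'I_#|B| * gas_total 'I_#|~: B|.
Proof.
rewrite /gas_total.
under eq_bigr => A _ do rewrite (moment_cumulants_pointed
  (independence_indicator0 R (overlap A)) (in_setT x)) mulr_suml.
rewrite exchange_big /=; apply: eq_big => [B|B]; first by rewrite subsetT.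
move=> /andP[_ xB].
pose u (j : 'I_#|B|) := enum_val j; pose v (j : 'I_#|~: B|) := enum_val j.
have uI : injective u by exact: enum_val_inj.
have vI : injective v by exact: enum_val_inj.
have uT : u @: setT = B.
  apply/setP => i; apply/imsetP/idP => [[j _ ->]|iB]; first exact: enum_valP.
  by exists (enum_rank_in iB i); rewrite // /u enum_rankK_in.
have vT : v @: setT = setT :\: B.
  rewrite setTD; apply/setP => i; apply/imsetP/idP => [[j _ ->]|iB].
    exact: enum_valP.
  by exists (enum_rank_in iB i); rewrite // /v enum_rankK_in.
pose uv (s : 'I_#|B| + 'I_#|~: B|) := match s with inl j => u j | inr k => v k end.
have uvI : injective uv.
  have ne j k : u j != v k.
    apply: contraTneq (enum_valP j) => ujk; have := enum_valP k.
    by rewrite -/(v k) -ujk inE.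
  move=> [j|k] [j'|k'] /= E.
  - by congr inl; exact: uI.
  - by have := ne j k'; rewrite E eqxx.
  - by have := ne j' k; rewrite E eqxx.
  - by congr inr; exact: vI.
have [w uvK wK] : bijective uv.
  by apply: inj_card_bij uvI _; rewrite card_sum !card_ord cardsC.
rewrite mulr_suml; under [RHS]eq_bigr do rewrite mulr_sumr.
rewrite -(big_ffun_split _ _ uvK wK); apply: eq_bigr => A _.
rewrite mulrACA; congr (_ * _ * _).
- rewrite -/(ursell _ _ _) -[in LHS]uT; apply/esym/ursell_imset => // i j _ _.
  exact: overlap_comp.
- congr (_%:R); congr (nat_of_bool _); rewrite -vT.
  by apply/esym/independent_imset => i j _ _; exact: overlap_comp.
- rewrite (bigID (mem B)) /=; congr (_ * _).
    by rewrite big_enum_val; apply: eq_bigr => j _; rewrite ffunE.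
  rewrite (eq_bigl (mem (~: B))) => [|i]; last by rewrite !inE.
  by rewrite big_enum_val; apply: eq_bigr => j _; rewrite ffunE.
Qed.

Lemma gas_total0 : gas_total 'I_0 = 1.
Proof.
have T0 : [set: 'I_0] = set0 by apply/setP => -[].
rewrite /gas_total (bigD1 (ffun0 (card_ord 0))) //=.
rewrite T0 independence_indicator0 big_ord0 mulr1 big1 ?addr0 // => A /eqP[].
by apply/ffunP => -[].
Qed.

Lemma gas_connected0 : gas_connected 'I_0 = 0.
Proof.
have T0 : [set: 'I_0] = set0 by apply/setP => -[].
by rewrite /gas_connected big1 // => A _; rewrite T0 /ursell cumulants_of0 mul0r.
Qed.

(** Sort the sets [B] by cardinal [k.+1]. For exponential generating functions this reads Z' = W' Z,
    the differential form of W = log Z. *)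
Lemma gas_total_rec n : gas_total 'I_n.+1 =
  \sum_(k < n.+1) (gas_connected 'I_k.+1 * gas_total 'I_(n - k)) *+ 'C(n, k).
Proof.
rewrite (gas_total_pointed ord0).
rewrite (partition_big (fun B : {set 'I_n.+1} => inord #|B|.-1 : 'I_n.+1) xpredT) //=.
apply: eq_bigr => k _; rewrite -card_sets_containing -sumr_const.
have E (B : {set 'I_n.+1}) : (ord0 \in B) && (inord #|B|.-1 == k) =
    (ord0 \in B) && (#|B| == k.+1).
  apply: andb_id2l => B0; have := max_card (mem B); rewrite card_ord.
  have : (0 < #|B|)%N by apply/card_gt0P; exists ord0.
  case: #|B| => // b _ bn; rewrite eqSS; apply/eqP/eqP => [<-|bk].
    by rewrite inordK.
  by rewrite /= bk inord_val.
apply: eq_big => B; first by rewrite E inE.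
rewrite E => /andP[_ /eqP Bk].
suff -> : #|~: B| = (n - k)%N by rewrite Bk.
by rewrite cardsCs setCK card_ord Bk subSS.
Qed.

End PolymerGas.

Definition intersects (T : finType) (A B : {set T}) := A :&: B != set0.

Definition disjoint_family (T : finType) (p : {set {set T}}) :=
  trivIset p && (set0 \notin p).

Lemma intersects_sym (T : finType) : symmetric (@intersects T).
Proof. by move=> A B; rewrite /intersects setIC. Qed.

(** * Gases of pairwise disjoint sets *)

Section SetPolymers.
Variables (R : comNzRingType) (T : finType) (z : {set T} -> R).

Lemma sum_partitions (F : {set {set T}} -> R) :
  \sum_(S : {set T}) \sum_(p | partition p S) F p =
  \sum_(p | disjoint_family p) F p.
Proof.
rewrite (exchange_big_dep (@disjoint_family T)) /= => [|S p _]; last first.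
  by case/and3P=> _ p1 p2; rewrite /disjoint_family p1.
apply: eq_bigr => p /andP[p1 p2]; rewrite (big_pred1 (cover p)) // => S.
by rewrite /partition p1 p2 !andbT eq_sym.
Qed.

Lemma independent_overlap_inj (I : finType) (A : {ffun I -> {set T}}) :
  independent (overlap (@intersects T) A) [set: I] -> (forall i, A i != set0) ->
  injective A.
Proof.
move=> /independentP Ai A0 i j Aij; apply/eqP; apply/negPn/negP => ij.
have /negP[] := Ai i j (in_setT i) (in_setT j).
by rewrite /overlap ij /intersects Aij setIid A0.
Qed.

Hypothesis z0 : z set0 = 0.

(** Disjoint nonempty sets are distinct, so a compatible tuple numbers its image without repetition;
    the left side is the form counted by [card_inj_ffuns_on]. *)
Lemma disjoint_family_image n (p : {set {set T}}) (A : {ffun 'I_n -> {set T}}) :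
  disjoint_family p -> #|p| = n ->
  (A \in ffun_on (mem p)) && injectiveb A =
  [&& independent (overlap (@intersects T) A) [set: 'I_n],
      [forall i, A i != set0] & A @: setT == p].
Proof.
move=> /andP[/trivIsetP pt p0] pn.
apply/andP/and3P =>
  [[/ffun_onP Ap /injectiveP AI]|[Aind /forallP A0 /eqP Ap]].
  split; last 1 first.
  - rewrite eqEcard card_imset // cardsT card_ord pn leqnn andbT.
    by apply/subsetP => _ /imsetP[i _ ->]; apply: Ap.
  - apply/independentP => i j _ _; apply/negP => /andP[ij].
    rewrite /intersects setI_eq0 pt //; try exact: Ap.
    by rewrite (inj_eq AI).
  - by apply/forallP => i; apply: contraNneq p0 => <-; apply: Ap.
split; first by apply/ffun_onP => i; rewrite -Ap imset_f.
by apply/injectiveP; apply: independent_overlap_inj A0.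
Qed.

Lemma gas_total_sets n : gas_total (@intersects T) z 'I_n =
  (\sum_(p | disjoint_family p && (#|p| == n)) \prod_(A in p) z A) *+ n`!.
Proof.
pose good (A : {ffun 'I_n -> {set T}}) :=
  independent (overlap (@intersects T) A) [set: 'I_n] && [forall i, A i != set0].
(* A tuple with an empty member has weight zero by [z0]; one with two meeting members has indicator
   zero. *)
rewrite /gas_total (bigID good) /= [X in _ + X]big1 ?addr0; last first.
  move=> A; rewrite negb_and => /orP[/negPf nA|/forallPn[i /negPn/eqP Ai]].
    by rewrite /independence_indicator nA mul0r.
  by rewrite (bigD1 i) //= Ai z0 mul0r mulr0.
rewrite (partition_big (fun A : {ffun 'I_n -> {set T}} => A @: setT)
  (fun p => disjoint_family p && (#|p| == n))) /=; last first.
  move=> A /andP[Aind /forallP A0]; have AI := independent_overlap_inj Aind A0.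
  move/independentP: Aind => Ai.
  rewrite card_imset // cardsT card_ord eqxx andbT; apply/andP; split.
    apply/trivIsetP => _ _ /imsetP[i _ ->] /imsetP[j _ ->] Aij.
    rewrite -setI_eq0; apply: contraR (Ai i j (in_setT i) (in_setT j)) => ij.
    by rewrite /overlap /intersects ij andbT; apply: contraNneq Aij => ->.
  by apply/imsetP => -[i _ /esym/eqP]; rewrite (negPf (A0 i)).
rewrite -sumrMnl; apply: eq_bigr => p /andP[pd /eqP pn].
have := card_inj_ffuns_on 'I_n (mem p); rewrite card_ord pn ffactnn => <-.
rewrite -sumr_const; apply: eq_big => A.
  by rewrite inE (disjoint_family_image _ pd pn) -andbA.
rewrite -andbA -disjoint_family_image // => AP.
have := AP; rewrite disjoint_family_image // => /and3P[Ai _ /eqP Ap].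
rewrite /independence_indicator Ai mul1r -Ap big_imset /=; last first.
  by case/andP: AP => _ /injectiveP AI i j _ _; apply: AI.
by apply: eq_bigl => i; rewrite inE.
Qed.

Lemma sum_disjoint_families K : (#|{set T}| < K)%N ->
  \sum_(p | disjoint_family p) \prod_(A in p) z A =
  \sum_(n < K) \sum_(p | disjoint_family p && (#|p| == n)) \prod_(A in p) z A.
Proof.
case: K => // K TK.
rewrite (partition_big (fun p : {set {set T}} => inord #|p| : 'I_K.+1) xpredT) //=.
apply: eq_bigr => n _; apply: eq_bigl => p; congr (_ && _).
by rewrite -val_eqE /= inordK // (leq_ltn_trans (max_card _)).
Qed.

End SetPolymers.

(** * Labelled bipartite graphs *)

Section Isomorphisms.
Implicit Types H K : bigraph.

Definition bimap H K (s : 'I_(nblack H) -> 'I_(nblack K))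
    (t : 'I_(nwhite H) -> 'I_(nwhite K)) (v : bvertex H) : bvertex K :=
  match v with inl x => inl (s x) | inr y => inr (t y) end.

Definition edge_preserving H K (s : 'I_(nblack H) -> 'I_(nblack K))
    (t : 'I_(nwhite H) -> 'I_(nwhite K)) : Prop :=
  forall x y, ((s x, t y) \in edges K) = ((x, y) \in edges H).

Lemma bimap_iso H K (s : 'I_(nblack H) -> 'I_(nblack K))
    (t : 'I_(nwhite H) -> 'I_(nwhite K)) :
  bijective s -> bijective t -> edge_preserving s t -> is_bigraph_iso (bimap s t).
Proof.
move=> [s' sK s'K] [t' tK t'K] st; split.
- exists (@bimap K H s' t') => -[x|y] /=; by rewrite ?sK ?tK ?s'K ?t'K.
- by case.
- by move=> [x|y] [x'|y'] /=.
Qed.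

Lemma bigraph_iso_bimap H K (f : bvertex H -> bvertex K) : is_bigraph_iso f ->
  exists s t, [/\ bijective s, bijective t, f =1 bimap s t & edge_preserving s t].
Proof.
case=> -[g fK gK] fb fe.
have gb v : is_black (g v) = is_black v by rewrite -fb gK.
(* Stated for arbitrary sums so that it applies both to [f] and to its inverse [g]. *)
have colour (I J I' J' : Type) (h : I + J -> I' + J') :
    (forall v, (if h v is inl _ then true else false) =
               (if v is inl _ then true else false)) ->
    exists s t, (forall x, h (inl x) = inl (s x)) /\ (forall y, h (inr y) = inr (t y)).
  move=> hb.
  have hl x : {x' | h (inl x) = inl x'}.
    by case E: (h (inl x)) (hb (inl x)) => [x'|y'] //= _; exists x'.
  have hr y : {y' | h (inr y) = inr y'}.
    by case E: (h (inr y)) (hb (inr y)) => [x'|y'] //= _; exists y'.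
  exists (fun x => sval (hl x)), (fun y => sval (hr y)).
  by split=> x; [exact: svalP (hl x)|exact: svalP (hr x)].
have [s [t [fs ft]]] := colour _ _ _ _ f fb.
have [s' [t' [gs gt]]] := colour _ _ _ _ g gb.
exists s, t; split.
- exists s' => x; first by have := fK (inl x); rewrite fs gs => -[].
  by have := gK (inl x); rewrite gs fs => -[].
- exists t' => y; first by have := fK (inr y); rewrite ft gt => -[].
  by have := gK (inr y); rewrite gt ft => -[].
- by case.
- by move=> x y; have := fe (inl x) (inr y); rewrite fs ft.
Qed.

Lemma bigraph_iso_nblack H K : bigraph_iso H K -> nblack H = nblack K.
Proof.
case/asboolP => f /bigraph_iso_bimap[s [t [sb _ _ _]]].
by have := bij_eq_card sb; rewrite !card_ord.
Qed.

Lemma bigraph_iso_connected H K :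
  bigraph_iso H K -> bigraph_connected H -> bigraph_connected K.
Proof.
case/asboolP => f [[g fK gK] _ fe] Hc.
have con u v : connect (@badj H) u v -> connect (@badj K) (f u) (f v).
  case/connectP => p; elim: p u => [|w p IHp] u /= => [_ ->//|].
  case/andP => uw wp vl; apply: connect_trans (IHp w wp vl).
  by apply: connect1; rewrite fe.
apply/forallP => u; apply/forallP => v; rewrite -(gK u) -(gK v); apply: con.
by have /forallP/(_ (g u))/forallP := Hc.
Qed.

Lemma bigraph_iso_order H K :
  bigraph_iso H K -> (nblack H + nwhite H = nblack K + nwhite K)%N.
Proof.
case/asboolP => f [fb _ _].
by have := bij_eq_card fb; rewrite !card_sum !card_ord.
Qed.

Definition bigraph_pair_Aut H :=
  [set st : {perm 'I_(nblack H)} * {perm 'I_(nwhite H)} |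
    `[< @edge_preserving H H st.1 st.2 >]].

Lemma card_bigraph_Aut H : #|bigraph_Aut H| = #|bigraph_pair_Aut H|.
Proof.
have bI (st : {perm 'I_(nblack H)} * {perm 'I_(nwhite H)}) :
    injective (@bimap H H st.1 st.2).
  by move=> [x|y] [x'|y'] //= [/perm_inj ->].
rewrite -(card_imset (bigraph_pair_Aut H) (f := fun st => perm (bI st))); last first.
  move=> [s t] [s' t'] /permP E; congr pair; apply/permP => x.
    by have := E (inl x); rewrite !permE /= => -[].
  by have := E (inr x); rewrite !permE /= => -[].
apply: eq_card => p; rewrite inE; apply/asboolP/imsetP => [|[[s t]]]; last first.
  rewrite inE => /asboolP st ->.
  have := @bimap_iso H H s t (injF_bij (@perm_inj _ s)) (injF_bij (@perm_inj _ t)) st.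
  case=> bb bl ba; split; first exact: injF_bij perm_inj.
    by move=> v; rewrite permE bl.
  by move=> u v; rewrite !permE ba.
case/bigraph_iso_bimap => s [t [sb tb pst est]].
exists (perm (bij_inj sb), perm (bij_inj tb)).
  by rewrite inE; apply/asboolP => x y; rewrite !permE est.
by apply/permP => -[x|y]; rewrite pst permE /= permE.
Qed.

Lemma bigraph_Aut_gt0 H : (0 < #|bigraph_Aut H|)%N.
Proof.
rewrite card_bigraph_Aut; apply/card_gt0P; exists (1%g, 1%g).
by rewrite inE; apply/asboolP => x y; rewrite !perm1.
Qed.

End Isomorphisms.

(** * Counting the numberings and labellings of a graph *)

Section Orbits.
Variables (T : finType) (H : bigraph).
Hypothesis Hw : forall y, exists x, (x, y) \in edges H.
Notation n := (nblack H).
Notation w := (nwhite H).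

Definition nbr_tuple (q : {perm 'I_n} * {ffun 'I_w -> T}) : {ffun 'I_n -> {set T}} :=
  [ffun i => q.2 @: white_nbrs (q.1 i)].

(* [(s, t)] in Aut H acts by [(s0, L0) |-> (s0 * s, L0 \o t^-1)]; the action is
   free and its orbits are the fibers of [nbr_tuple]. *)
Lemma card_nbr_tuple_fiber (q0 : {perm 'I_n} * {ffun 'I_w -> T}) : injective q0.2 ->
  #|[set q : {perm 'I_n} * {ffun 'I_w -> T} |
      injectiveb q.2 && (nbr_tuple q == nbr_tuple q0)]| = #|bigraph_Aut H|.
Proof.
case: q0 => /= s0 L0 L0I; rewrite card_bigraph_Aut.
pose Phi (st : {perm 'I_n} * {perm 'I_w}) : {perm 'I_n} * {ffun 'I_w -> T} :=
  ((s0 * st.1)%g, [ffun y => L0 (st.2^-1%g y)]).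
rewrite -(card_imset _ (f := Phi)); last first.
  move=> [s t] [s' t'] [/mulgI -> /ffunP E]; congr pair; apply: invg_inj.
  by apply/permP => y; apply: L0I; have := E y; rewrite !ffunE.
apply: eq_card => -[s L]; rewrite inE /=; apply/idP/imsetP => [|[[s' t]]]; last first.
  rewrite inE => /asboolP st [-> ->]; apply/andP; split.
    by apply/injectiveP => y y'; rewrite !ffunE => /L0I/perm_inj.
  apply/eqP/ffunP => i; rewrite !ffunE /= permM.
  have -> : white_nbrs (s' (s0 i)) = t @: white_nbrs (s0 i).
    apply/setP => y; rewrite -[y](permKV t) mem_imset; last exact: perm_inj.
    by rewrite !inE st.
  by rewrite -imset_comp; apply: eq_imset => y; rewrite /= ffunE permK.
case/andP => /injectiveP LI /eqP/ffunP E.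
have E' i : L @: white_nbrs (s i) = L0 @: white_nbrs (s0 i).
  by have := E i; rewrite !ffunE.
(* [y] has a neighbour, so its label [L0 y] occurs in some set of the common tuple and is also a
   value of [L]. *)
have tP y : {y' | L y' = L0 y}.
  apply: cid; have [x xy] := Hw y; have := E' (s0^-1%g x); rewrite permKV => Ex.
  have : L0 y \in L @: white_nbrs (s (s0^-1%g x)).
    by rewrite Ex imset_f // inE.
  by case/imsetP => y' _ ->; exists y'.
have tI : injective (fun y => sval (tP y)).
  by move=> y y' /(congr1 L); rewrite !(svalP (tP _)) => /L0I.
have Lt y : L (perm tI y) = L0 y by rewrite permE (svalP (tP y)).
exists ((s0^-1 * s)%g, perm tI); last first.
  rewrite /Phi /= mulKVg; congr pair; apply/ffunP => y.
  by rewrite ffunE -Lt permKV.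
rewrite inE; apply/asboolP => x y; rewrite /= permM.
have -> : ((s (s0^-1%g x), perm tI y) \in edges H) =
    (L (perm tI y) \in L @: white_nbrs (s (s0^-1%g x))).
  by rewrite mem_imset // inE.
by rewrite E' permKV Lt mem_imset // inE.
Qed.

(** Sum over the pairs [(s, L)] in two ways: [s] contributes a factor n!, and each tuple that occurs
    does so [#|bigraph_Aut H|] times. *)
Lemma orbit_count (V : nmodType) (F : {ffun 'I_n -> {set T}} -> V)
    (g : {ffun 'I_w -> T} -> V) :
  (forall s (L : {ffun 'I_w -> T}), injective L -> F (nbr_tuple (s, L)) = g L) ->
  (\sum_(L : {ffun 'I_w -> T} | injectiveb L) g L) *+ n`! =
  (\sum_(A in [set nbr_tuple q |
           q in [set q : {perm 'I_n} * {ffun 'I_w -> T} | injectiveb q.2]]) F A)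
    *+ #|bigraph_Aut H|.
Proof.
move=> Fg.
transitivity (\sum_(q in [set q : {perm 'I_n} * {ffun 'I_w -> T} | injectiveb q.2])
    F (nbr_tuple q)).
  rewrite -card_Sn -sumr_const pair_big /=.
  by apply: eq_big => [[s L]|[s L] /injectiveP LI] /=; rewrite ?inE ?Fg.
rewrite (partition_big_imset nbr_tuple) /= -sumrMnl; apply: eq_bigr => A.
case/imsetP => q0; rewrite inE => /injectiveP q0I ->.
rewrite -(card_nbr_tuple_fiber q0I) -sumr_const.
apply: eq_big => q; first by rewrite !inE.
by rewrite inE => /andP[_ /eqP ->].
Qed.

End Orbits.

Section TupleBigraph.
Variable T : finType.

(* The white vertices are the elements of the union of the sets of the tuple. *)
Definition tuple_bigraph n (A : {ffun 'I_n -> {set T}}) : bigraph :=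
  @Bigraph n #|\bigcup_i A i| [set xy | enum_val xy.2 \in A xy.1].

(** An isomorphism onto [H] amounts to a numbering of its black vertices and an injective labelling
    of its white ones that give back [A]. *)
Lemma tuple_bigraph_iso (H : bigraph) (A : {ffun 'I_(nblack H) -> {set T}}) :
  (forall y, exists x, (x, y) \in edges H) ->
  bigraph_iso (tuple_bigraph A) H =
  (A \in [set nbr_tuple q |
           q in [set q : {perm 'I_(nblack H)} * {ffun 'I_(nwhite H) -> T} |
                  injectiveb q.2]]).
Proof.
move=> Hw; apply/asboolP/imsetP => [[f]|[[s L]]]; last first.
  rewrite inE /= => /injectiveP LI E.
  have Ax x : A x = L @: white_nbrs (s x) by rewrite E ffunE.
  have tP (y : 'I_#|\bigcup_i A i|) : {y' | L y' = enum_val y}.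
    apply: cid; have /bigcupP[x _] := enum_valP y.
    by rewrite Ax => /imsetP[y' _ ->]; exists y'.
  have [t Lt] : exists t : 'I_#|\bigcup_i A i| -> 'I_(nwhite H),
      forall y, L (t y) = enum_val y.
    by exists (fun y => sval (tP y)) => y; exact: svalP (tP y).
  have tI : injective t by move=> y y' /(congr1 L); rewrite !Lt => /enum_val_inj.
  exists (@bimap (tuple_bigraph A) H s t).
  apply: bimap_iso; first exact: (injF_bij (@perm_inj _ s)).
    (* Bijectivity by counting: each white vertex of [H] has a neighbour, so every label lies in the
       union of the sets. *)
    apply: inj_card_bij tI _; rewrite !card_ord.
    rewrite -[X in (X <= _)%N]card_ord -cardsT -(card_imset _ LI).
    apply/subset_leq_card/subsetP => _ /imsetP[y _ ->].
    have [x xy] := Hw y; apply/bigcupP; exists (s^-1%g x) => //.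
    by rewrite Ax permKV imset_f // inE.
  by move=> x y; rewrite inE /= Ax -Lt mem_imset // inE.
case/bigraph_iso_bimap => s [t [sb [t' tK t'K] _ st]].
exists (perm (bij_inj sb), [ffun y => enum_val (t' y)]).
  rewrite inE; apply/injectiveP => y y'; rewrite !ffunE => /enum_val_inj.
  exact: can_inj t'K _ _.
apply/ffunP => i; rewrite ffunE /= permE; apply/setP => z.
apply/idP/imsetP => [zA|[y yi ->]].
  have zc : z \in \bigcup_i A i by apply/bigcupP; exists i.
  exists (t (enum_rank_in zc z)); last by rewrite ffunE tK enum_rankK_in.
  by rewrite inE st inE /= enum_rankK_in.
by rewrite ffunE; move: yi; rewrite inE -{1}[y]t'K st inE.
Qed.

(** A nonzero Ursell value forces the overlap graph to be connected, and an element common to two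
    sets is a white vertex joining them. *)
Lemma tuple_bigraph_connected (R : comNzRingType) n (A : {ffun 'I_n -> {set T}}) :
  (forall i, A i != set0) -> ursell R (overlap (@intersects T) A) [set: 'I_n] != 0 ->
  bigraph_connected (tuple_bigraph A) /\
  (2 <= nblack (tuple_bigraph A) + nwhite (tuple_bigraph A))%N.
Proof.
move=> A0 uA.
have [i0 _] : exists i0 : 'I_n, i0 \in setT.
  by apply/set0Pn; apply: contraNneq uA => ->; rewrite /ursell cumulants_of0.
have osym := overlap_sym (@intersects_sym T) A.
have oc i j : connect (overlap (@intersects T) A) i j.
  apply: contraNT uA => nij; apply/eqP.
  pose C := [set k | connect (overlap (@intersects T) A) i k].
  apply: (@ursell_eq0 _ _ _ _ C) => //.
  - by apply/set0Pn; exists i; rewrite !inE connect0.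
  - by apply/set0Pn; exists j; rewrite !inE nij.
  - move=> u v; rewrite !inE => iu /andP[iv _]; apply: contra iv => uv.
    exact: connect_trans iu (connect1 uv).
pose K := tuple_bigraph A; pose bl (i : 'I_n) : bvertex K := inl i.
have bsym : connect_sym (@badj K).
  by apply: sym_connect_sym => -[x|y] [x'|y'].
have bc i j : connect (@badj K) (bl i) (bl j).
  have /connectP[p] := oc i j; elim: p i => [|k p IHp] i /= => [_ ->//|].
  case/andP => /andP[ik /set0Pn[z]]; rewrite inE => /andP[zi zk] kp jl.
  apply: connect_trans (IHp k kp jl).
  have zc : z \in \bigcup_i A i by apply/bigcupP; exists i.
  apply: (@connect_trans _ _ (inr (enum_rank_in zc z) : bvertex K)).
    by apply: connect1; rewrite /= inE /= enum_rankK_in.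
  by apply: connect1; rewrite /= inE /= enum_rankK_in.
have b0 v : connect (@badj K) (bl i0) v.
  case: v => [x|y]; first exact: bc.
  have /bigcupP[i _ yi] := enum_valP y.
  by apply: connect_trans (bc i0 i) (connect1 _); rewrite /= inE.
split.
  apply/forallP => u; apply/forallP => v.
  by apply: connect_trans (b0 v); rewrite bsym.
have n0 : (0 < n)%N by apply: leq_ltn_trans (ltn_ord i0).
have : (0 < #|\bigcup_i A i|)%N.
  have /set0Pn[z zA] := A0 i0.
  by apply/card_gt0P; exists z; apply/bigcupP; exists i0.
by move=> w0; rewrite -[2%N]/(1 + 1)%N leq_add.
Qed.

End TupleBigraph.

Section Connected.
Variable H : bigraph.
Hypothesis Hc : bigraph_connected H.

Lemma white_has_nbr : (2 <= nblack H + nwhite H)%N ->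
  forall y, exists x, (x, y) \in edges H.
Proof.
move=> H2 y.
have /card_gt0P[v] : (0 < #|predC1 (inr y : bvertex H)|)%N.
  by rewrite cardC1 card_sum !card_ord -subn1 subn_gt0.
have /forallP/(_ (inr y))/forallP/(_ v)/connectP[[|u p] /=] := Hc.
  by move=> _ ->; rewrite !inE eqxx.
by case: u => [x|//] /andP[xy _] _ _; exists x.
Qed.

Lemma connected_nblack_gt0 : (2 <= nblack H + nwhite H)%N -> (0 < nblack H)%N.
Proof.
move=> H2; rewrite lt0n; apply/eqP => H0.
have y : 'I_(nwhite H) by apply: (@Ordinal _ 0); rewrite H0 in H2; apply: ltnW H2.
by have [x _] := white_has_nbr H2 y; have := ltn_ord x; rewrite [X in (_ < X)%N]H0.
Qed.

Lemma black_graph_connected x y : connect (black_graph H) x y.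
Proof.
have /forallP/(_ (inl x))/forallP/(_ (inl y))/connectP[p] := Hc.
(* Invariant along the path: at a white vertex all its black neighbours are reached, since any two
   of them are equal or adjacent in [black_graph H]. *)
pose reach (v : bvertex H) : Prop := match v with
  | inl z => is_true (connect (black_graph H) x z)
  | inr u => forall z, (z, u) \in edges H -> connect (black_graph H) x z end.
suff reachP v : reach v -> path (@badj H) v p -> reach (last v p).
  by move=> /(reachP (inl x) (connect0 _ _)) /[swap] <-.
elim: p v => //= u p IHp v rv /andP[vu up]; apply: IHp up.
case: v u vu rv => [z|u] [z'|u'] //= vu rv; last exact: rv.
move=> z' zu; have [->//|zz'] := eqVneq z' z.
apply: connect_trans rv (connect1 _).
change (is_true (black_rel z z')); rewrite /black_rel /= eq_sym zz' /=.
by apply/set0Pn; exists u'; rewrite !inE vu zu.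
Qed.

End Connected.

From mathcomp Require Import all_classical all_reals all_analysis.

(** * Exponential and logarithm of formal power series *)

Section Vanishing.
Variables (N : nat) (R : comNzRingType).
Implicit Types (f g : fps N R) (m : expo N).

Definition vanishes k f := forall m, (expo_deg m < k)%N -> f m = 0.

Lemma fps_coef_sum (I : Type) (r : seq I) (Q : pred I) (F : I -> fps N R) m :
  (\sum_(i <- r | Q i) F i) m = \sum_(i <- r | Q i) F i m.
Proof. by elim/big_rec2: _ => // i x f _ <-. Qed.

Lemma fps_coefZ (x : R) f m : (x *: f) m = x * f m.
Proof. by []. Qed.

Lemma fps_coefMn f n m : (f *+ n) m = f m *+ n.
Proof.
by rewrite -[n]card_ord -!sumr_const fps_coef_sum.
Qed.

Lemma expo_degD m m' : expo_deg (m + m') = (expo_deg m + expo_deg m')%N.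
Proof.
by rewrite /expo_deg -big_split; apply: eq_bigr => i _; rewrite ffunE.
Qed.

Lemma vanishes_leq k l f : (k <= l)%N -> vanishes l f -> vanishes k f.
Proof. by move=> kl lf m mk; apply: lf; apply: leq_trans kl. Qed.

Lemma vanishesD k f g : vanishes k f -> vanishes k g -> vanishes k (f + g).
Proof.
move=> kf kg m mk; suff : f m + g m = 0 by [].
by rewrite kf // kg // addr0.
Qed.

Lemma vanishesZ k x f : vanishes k f -> vanishes k (x *: f).
Proof. by move=> kf m mk; suff : x * f m = 0 by []; rewrite kf ?mulr0. Qed.

Lemma vanishesN k f : vanishes k f -> vanishes k (- f).
Proof. by move=> kf; rewrite -scaleN1r; apply: vanishesZ. Qed.

Lemma vanishes_sum k (I : Type) (r : seq I) (Q : pred I) (F : I -> fps N R) :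
  (forall i, Q i -> vanishes k (F i)) -> vanishes k (\sum_(i <- r | Q i) F i).
Proof.
move=> kF; elim/big_ind: _ => //; last exact: vanishesD.
Qed.

Lemma vanishesM k l f g : vanishes k f -> vanishes l g -> vanishes (k + l) (f * g).
Proof.
move=> kf lg m mkl; suff : fps_mul f g m = 0 by [].
rewrite (@fps_mulE _ _ m m 0) ?addr0 // big1 // => a _; rewrite big1 // => b _.
case: eqP => // abm; have [ka|ak] := leqP k (expo_deg a); last by rewrite kf ?mul0r.
rewrite lg ?mulr0 //; move: mkl; rewrite -abm expo_degD => ab.
by rewrite -(ltn_add2l k) (leq_ltn_trans _ ab) // leq_add2r.
Qed.

Lemma vanishes_prod (I : finType) (F : I -> fps N R) (k : I -> nat) (Q : pred I) :
  (forall i, Q i -> vanishes (k i) (F i)) ->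
  vanishes (\sum_(i | Q i) k i)%N (\prod_(i | Q i) F i).
Proof.
move=> kF; elim/big_rec2: _ => // i f l Qi lf.
by apply: vanishesM => //; apply: kF.
Qed.

(** The exponent of the counting variable bounds the order of its coefficient from below, so
    evaluation at 1 is determined in degree below [k] by the first [k] coefficients. *)
Definition graded (p : {poly fps N R}) := forall k, vanishes k p`_k.

Lemma gradedD p q : graded p -> graded q -> graded (p + q).
Proof. by move=> gp gq k; rewrite coefD; apply: vanishesD. Qed.

Lemma gradedN p : graded p -> graded (- p).
Proof. by move=> gp k; rewrite coefN; apply: vanishesN. Qed.

Lemma gradedZ c p : graded p -> graded (c *: p).
Proof.
by move=> gp k; rewrite coefZ -[k]add0n; apply: vanishesM => //; apply: gp.
Qed.

Lemma gradedM p q : graded p -> graded q -> graded (p * q).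
Proof.
move=> gp gq k; rewrite coefM; apply: vanishes_sum => i _.
by rewrite -[X in vanishes X](@subnKC i k) -1?ltnS //; apply: vanishesM.
Qed.

Lemma graded1 : graded 1.
Proof. by move=> [|k]; rewrite coef1. Qed.

Lemma gradedX p n : graded p -> graded (p ^+ n).
Proof.
move=> gp; elim: n => [|n IHn]; first exact: graded1.
by rewrite exprS; apply: gradedM.
Qed.

Lemma graded_sum (I : Type) (r : seq I) (Q : pred I) (F : I -> {poly fps N R}) :
  (forall i, Q i -> graded (F i)) -> graded (\sum_(i <- r | Q i) F i).
Proof.
move=> gF; elim/big_ind: _ => //; last exact: gradedD.
by move=> k; rewrite coef0.
Qed.

End Vanishing.

(** * The logarithm through its differential equation *)

Section LogRecursion.
Variables (N : nat) (R : numFieldType) (a c : nat -> fps N R).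
Hypotheses (a0 : a 0 = 1) (c0 : c 0 = 0).
Hypotheses (va : forall n, vanishes n (a n)) (vc : forall n, vanishes n (c n)).
Hypothesis ac : forall n,
  a n.+1 *+ n.+1 = \sum_(k < n.+1) (c k.+1 *+ k.+1) * a (n - k).

(* Over the polynomial ring in a counting variable t, the sums Z of a n t^n and W
   of c n t^n satisfy W' Z = Z' by [ac], and so does the truncated log Z in
   place of W, up to high powers of t.  Hence W and log Z agree in low degree in t,
   and since the coefficient of t^n vanishes below degree n, setting t = 1 gives
   the claim. *)
Lemma log_recursion K : vanishes K.+1
  (\sum_(j < K) ((-1) ^+ j / j.+1%:R : R) *: (\sum_(n < K.+1) a n - 1) ^+ j.+1
   - \sum_(n < K.+1) c n).
Proof.
pose Z : {poly fps N R} := \poly_(n < K.+1) a n.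
pose W : {poly fps N R} := \poly_(n < K.+1) c n.
pose u := Z - 1.
pose L := \sum_(j < K) (((-1) ^+ j / j.+1%:R : R)%:A : fps N R) *: u ^+ j.+1.
have gZ : graded Z by move=> k; rewrite coef_poly; case: ifP.
have gW : graded W by move=> k; rewrite coef_poly; case: ifP.
have gu : graded u by apply: gradedD => //; apply: gradedN; apply: graded1.
have gL : graded L by apply: graded_sum => j _; apply: gradedZ; apply: gradedX.
have hsum (b : nat -> fps N R) : (\poly_(n < K.+1) b n).[1] = \sum_(n < K.+1) b n.
  by rewrite horner_poly; apply: eq_bigr => n _; rewrite expr1n mulr1.
have -> : \sum_(j < K) ((-1) ^+ j / j.+1%:R : R) *: (\sum_(n < K.+1) a n - 1) ^+ j.+1
    - \sum_(n < K.+1) c n = (L - W).[1].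
  rewrite hornerD hornerN !hsum /L; congr (_ - _).
  rewrite horner_sum; apply: eq_bigr => j _.
  rewrite hornerZ horner_exp /u hornerD hornerN hsum hornerC.
  by rewrite -scalerAl mul1r.
(* Since [a 0 = 1], [u] is divisible by the counting variable, and [(- u) ^+ K] does not contribute
   below exponent [K]. *)
have u0 : u = drop_poly 1 u * 'X.
  rewrite -[LHS](poly_take_drop 1) expr1 (_ : take_poly 1 u = 0) ?add0r //.
  apply/polyP => -[|k]; rewrite coef_take_poly ?coef0 //=.
  by rewrite coefB coef_poly /= a0 coef1 subrr.
(* The derivative of the truncated logarithm is u' times a geometric sum of ratio [- u], which
   multiplication by [Z = 1 + u] telescopes. *)
have dL : L^`() * Z = u^`() * (1 - (- u) ^+ K).
  have -> : L^`() = u^`() * \sum_(j < K) (- u) ^+ j.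
    rewrite /L raddf_sum mulr_sumr /=; apply: eq_bigr => j _.
    rewrite derivZ deriv_exp /= -scalerMnr scalerMnl.
    have -> : (((-1) ^+ j / j.+1%:R : R)%:A : fps N R) *+ j.+1 = (-1) ^+ j.
      rewrite scalerMnl -mulr_natr divfK ?pnatr_eq0 //.
      by rewrite -[LHS]/(in_alg (fps N R) _) rmorphXn rmorphN1.
    by rewrite [in RHS]exprNn -mul_polyC rmorphXn rmorphN1 mulrCA.
  rewrite -mulrA; congr (_ * _).
  have -> : Z = - (- u - 1) by rewrite opprB opprK addrC subrK.
  by rewrite mulrN mulrC -subrX1 opprB.
have dW k : (k < K)%N -> (W^`() * Z)`_k = (u^`())`_k.
  move=> kK; rewrite coefM coef_deriv coefB coef1 subr0 coef_poly ltnS kK ac.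
  apply: eq_bigr => i _.
  have iK : (i.+1 < K.+1)%N by rewrite ltnS (leq_trans (ltn_ord i) kK).
  have kiK : (k - i < K.+1)%N by rewrite ltnS (leq_trans (leq_subr _ _)) // ltnW.
  by rewrite coef_deriv !coef_poly iK kiK.
have uK k : (k < K)%N -> (u^`() * (1 - (- u) ^+ K))`_k = (u^`())`_k.
  move=> kK; rewrite mulrBr mulr1 coefB u0 -mulNr exprMn mulrA coefMXn kK.
  by rewrite subr0.
(* [Z] has constant coefficient 1, so the coefficients of the product determine those of the
   difference one after another. *)
have dLW k : (k < K)%N -> (L^`() - W^`())`_k = 0.
  elim/ltn_ind: k => k IHk kK.
  have : ((L^`() - W^`()) * Z)`_k = 0.
    by rewrite mulrBl dL coefB uK // dW // subrr.
  rewrite coefM big_ord_recr /= subnn coef_poly /= a0 mulr1.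
  rewrite big1 ?add0r // => i _; rewrite IHk ?mul0r //.
  exact: ltn_trans kK.
have LW k : (k <= K)%N -> (L - W)`_k = 0.
  case: k => [_|k kK].
    rewrite coefB coef_poly /= c0 subr0 coef_sum big1 // => j _.
    by rewrite coefZ u0 exprMn coefMXn mulr0.
  have := dLW k kK; rewrite -derivB coef_deriv => /fpsP E.
  apply/fpsP => m; have := E m; rewrite fps_coefMn => /eqP.
  by rewrite mulrn_eq0 => /eqP.
rewrite horner_coef; apply: vanishes_sum => k _; rewrite expr1n mulr1.
have [kK|Kk] := leqP k K; first by rewrite LW.
apply: vanishes_leq Kk _; exact: gradedD gL (gradedN gW) _.
Qed.
End LogRecursion.

Local Open Scope classical_set_scope.

Lemma graded_horner1 (N : nat) (R : comNzRingType) (p : {poly fps N R}) k m :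
  graded p -> (expo_deg m < k)%N -> p.[1] m = (\sum_(n < k) p`_n) m.
Proof.
move=> gp mk; rewrite (@horner_coef_wide _ (maxn (size p) k)) ?leq_maxl //.
under eq_bigr do rewrite expr1n mulr1.
rewrite -!(big_mkord xpredT (fun n => p`_n)).
rewrite (@big_cat_nat _ _ _ k) ?leq_maxr //= -[RHS]addr0.
rewrite -[LHS]/(fps_coef _ m + fps_coef _ m); congr (_ + _).
rewrite fps_coef_sum big_nat big1 // => n /andP[kn _].
by apply: gp; apply: leq_trans kn.
Qed.

Section Exponential.
Variables (N : nat) (R : realType).
Implicit Types (f g : fps N R) (m : expo N).

Lemma fps_sum_seq (I : choiceType) (D : set I) (F : I -> fps N R) (r : seq I) m :
  uniq r -> [set` r] `<=` D -> (forall i, D i -> i \notin r -> F i m = 0) ->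
  fps_sum D F m = \sum_(i <- r) F i m.
Proof.
move=> ur rD F0; rewrite /= (fsbigE r) // big_seq_cond [RHS]big_seq_cond.
apply: eq_bigl => i; rewrite andbT; case ir: (i \in r) => //=.
by apply/mem_set/rD.
Qed.

Lemma vanishes_scaled_expr (x : R) f n : f 0 = 0 -> vanishes n (x *: f ^+ n).
Proof. by move=> f0; apply: vanishesZ => m; apply: fps_exprn_eq0. Qed.

Lemma fps_exp_coef f k m : f 0 = 0 -> (expo_deg m < k)%N ->
  fps_exp f m = (\sum_(n < k) fps_exp_term f n) m.
Proof.
move=> f0 mk; rewrite (@fps_sum_seq _ _ _ (iota 0 k)) ?iota_uniq //.
  rewrite fps_coef_sum -(big_mkord xpredT (fun n => fps_exp_term f n m)).
  by rewrite /index_iota subn0.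
move=> n _; rewrite mem_iota add0n /= -leqNgt => kn.
by apply: vanishes_scaled_expr (leq_trans mk kn).
Qed.

(** With the index shifted to [j = n - 1], [k] terms reach the power [k], which suffices up to
    degree [k] included. *)
Lemma fps_log_coef f k m : f 0 = 1 -> (expo_deg m <= k)%N ->
  fps_log f m =
  (\sum_(j < k) ((-1) ^+ j / j.+1%:R : R) *: (f - 1) ^+ j.+1) m.
Proof.
move=> f1 mk; have f0 : (f - 1) 0 = 0.
  by rewrite -[LHS]/(f 0 - (0 == 0 :> expo N)%:R) eqxx f1 subrr.
rewrite (@fps_sum_seq _ _ _ (iota 1 k)) ?iota_uniq //.
- rewrite fps_coef_sum (iotaDl 1 0) big_map.
  rewrite -(big_mkord xpredT
    (fun j => (((-1) ^+ j / j.+1%:R : R) *: (f - 1) ^+ j.+1) m)).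
  by rewrite /index_iota subn0.
- by move=> n /=; rewrite mem_iota => /andP[].
- move=> n /= n0; rewrite mem_iota n0 add1n /= -ltnNge => kn.
  by apply: vanishes_scaled_expr (leq_ltn_trans mk kn).
Qed.

Lemma fps_scaleM (x y : R) f g : (x *: f) * (y *: g) = (x * y) *: (f * g).
Proof.
rewrite -scalerAl -scalerA; congr (_ *: _).
by rewrite mulrC -scalerAl mulrC.
Qed.

Lemma fps_scale_prod (I : finType) (Q : pred I) (x : I -> R) (F : I -> fps N R) :
  \prod_(i | Q i) (x i *: F i) = (\prod_(i | Q i) x i) *: \prod_(i | Q i) F i.
Proof.
elim/big_rec3: _ => [|i y1 y2 y3 _ ->]; first by rewrite scale1r.
by rewrite fps_scaleM.
Qed.

Lemma invf_fact_bin n i : (i <= n)%N ->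
  n`!%:R^-1 *+ 'C(n, i) = i`!%:R^-1 * (n - i)`!%:R^-1 :> R.
Proof.
move=> i_n; rewrite -[_ *+ _]mulr_natr -(bin_fact i_n) !natrM !invfM.
by rewrite mulrAC mulVf ?mul1r // pnatr_eq0 -lt0n bin_gt0.
Qed.

(** Polynomials in a counting variable turn a product of exponentials into a Cauchy product, which
    the binomial theorem evaluates. *)
Lemma fps_exp_lift f k : f 0 = 0 ->
  exists2 p : {poly fps N R}, graded p &
    (forall j, (j < k)%N -> p`_j = fps_exp_term f j) /\
    vanishes k (fps_exp f - p.[1]).
Proof.
move=> f0; exists (\poly_(n < k) fps_exp_term f n); last split.
- move=> n; rewrite coef_poly; case: ifP => // _.
  exact: vanishes_scaled_expr.
- by move=> j jk; rewrite coef_poly jk.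
- move=> m mk; rewrite -[LHS]/(fps_exp f m - (\poly_(n < k) fps_exp_term f n).[1] m).
  rewrite (fps_exp_coef f0 mk) horner_poly.
  by under [X in _ - fps_coef X _]eq_bigr do rewrite expr1n mulr1; rewrite subrr.
Qed.

Lemma fps_expD f g : f 0 = 0 -> g 0 = 0 ->
  fps_exp (f + g) = fps_exp f * fps_exp g.
Proof.
move=> f0 g0; apply/fpsP => m; set k := (expo_deg m).+1.
have fg0 : (f + g) 0 = 0 by rewrite -[LHS]/(f 0 + g 0) f0 g0 addr0.
rewrite (fps_exp_coef fg0 (leqnn k)).
have [p gp [pk fp]] := fps_exp_lift k f0.
have [q gq [qk gq1]] := fps_exp_lift k g0.
(* Replacing both exponentials by their lifts costs only terms of order at least [k], which vanish
   at [m]. *)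
have -> : fps_exp f * fps_exp g = p.[1] * q.[1]
    + (p.[1] * (fps_exp g - q.[1]) + (fps_exp f - p.[1]) * fps_exp g).
  by rewrite [X in _ + X]addrC mulrBl mulrBr subrKA addrC subrK.
rewrite -[RHS]/((p.[1] * q.[1]) m + fps_coef (_ + _) m).
rewrite [X in _ = _ + X](_ : _ = 0) ?addr0; last first.
  apply: (@vanishesD _ _ k) (leqnn _).
    by rewrite -[k]add0n; apply: vanishesM.
  by rewrite -[k]addn0; apply: vanishesM.
rewrite -hornerM (graded_horner1 _ (leqnn k)); last exact: gradedM.
congr (fps_coef _ m); apply: eq_bigr => n _.
rewrite coefM /fps_exp_term addrC exprDn scaler_sumr; apply: eq_bigr => i _.
have i_n : (i <= n)%N by rewrite -ltnS.
rewrite pk ?(leq_ltn_trans i_n) // qk ?(leq_ltn_trans (leq_subr _ _)) //.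
rewrite /fps_exp_term fps_scaleM [f ^+ i * _]mulrC.
by rewrite -[_ *: (_ *+ _)]scalerMnr [LHS]scalerMnl invf_fact_bin.
Qed.

Lemma fps_exp0 : fps_exp (0 : fps N R) = 1.
Proof.
apply/fpsP => m; rewrite (fps_exp_coef _ (leqnn (expo_deg m).+1)) //.
rewrite big_ord_recl big1 ?addr0 => [|i _].
  by rewrite /fps_exp_term expr0 invr1 scale1r.
by rewrite /fps_exp_term exprS mul0r scaler0.
Qed.

Lemma fps_var0 (i : 'I_N) : fps_var R i 0 = 0.
Proof.
rewrite /= [_ == _](_ : _ = false) //; apply/eqP => /ffunP/(_ i).
by rewrite !ffunE eqxx.
Qed.

Lemma vanishes_e (i : 'I_N) : vanishes 1 (fps_e R i).
Proof.
move=> m m1; rewrite -[LHS]/(fps_exp _ m - (1 : fps N R) m).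
rewrite (fps_exp_coef (fps_var0 i) m1) big_ord_recl big_ord0 addr0.
by rewrite /fps_exp_term expr0 invr1 scale1r subrr.
Qed.

Lemma fps_exp_linear01 (x : 'I_N -> R) : (forall i, x i = 0 \/ x i = 1) ->
  fps_exp (\sum_(i < N) x i *: fps_var R i) =
  \sum_(S : {set 'I_N}) (\prod_(i in S) x i) *: \prod_(i in S) fps_e R i.
Proof.
move=> x01.
(* The zero constant term is carried through the induction because [fps_expD] requires it. *)
have [_ ->] : (\sum_(i < N) x i *: fps_var R i) 0 = 0 /\
    fps_exp (\sum_(i < N) x i *: fps_var R i) = \prod_(i < N) (x i *: fps_e R i + 1).
  elim/big_rec2: _ => [|i f g _ [g0 gE]]; first by split=> //; exact: fps_exp0.
  have v0 : (x i *: fps_var R i) 0 = 0.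
    by rewrite -[LHS]/(x i * fps_var R i 0) fps_var0 mulr0.
  split; first by rewrite -[LHS]/((x i *: fps_var R i) 0 + g 0) v0 g0 addr0.
  rewrite fps_expD // gE.
  suff -> : fps_exp (x i *: fps_var R i) = x i *: fps_e R i + 1 by [].
  case: (x01 i) => ->.
    by rewrite !scale0r add0r fps_exp0.
  by rewrite !scale1r subrK.
rewrite bigA_distr; apply: eq_bigr => S _.
rewrite -fps_scale_prod [RHS]big_mkcond /=.
by apply: eq_bigr => i _; case: ifP.
Qed.

End Exponential.

(** * The cluster expansion *)

Section GeneratingFunction.
Context d (T : measurableType d) (R : realType) (P : probability T R).
Variables (N : nat) (b : 'I_N -> {RV P >-> R}).
Hypothesis b01 : forall i t, b i t = 0 \/ b i t = 1.

Lemma integrable_prod01 (S : {set 'I_N}) :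
  P.-integrable setT (EFin \o (fun t => \prod_(i in S) b i t)).
Proof.
apply: measurable_bounded_integrable => //; first exact: fin_num_fun_lty.
  under eq_fun do rewrite big_mkcond /=.
  apply: measurable_prod => i _; case: (i \in S); last exact: measurable_cst.
  exact: (measurable_funPT (b i)).
exists 1; split; first exact: num_real.
move=> M M1 t _ /=; apply: le_trans (ltW M1).
elim/big_ind: _ => [|x y x1 y1|i _]; first by rewrite normr1.
  by rewrite normrM mulr_ile1.
by case: (b01 i t) => ->; rewrite ?normr0 ?normr1.
Qed.

(** Each coefficient is a finite combination of products of the [b i] with deterministic
    coefficients, so linearity of the expectation applies. *)
Lemma expectation_exp_linear :
  fps_expectation P (fun t => fps_exp (\sum_(i < N) b i t *: fps_var R i)) =
  \sum_(S : {set 'I_N}) joint_moment b S *: \prod_(i in S) fps_e R i.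
Proof.
apply/fpsP => m; rewrite fps_coef_sum.
have expE t : fps_exp (\sum_(i < N) b i t *: fps_var R i) m =
    \sum_(S : {set 'I_N}) (\prod_(i in S) b i t) * (\prod_(i in S) fps_e R i) m.
  by rewrite (@fps_exp_linear01 _ _ (fun i => b i t)) // fps_coef_sum.
rewrite -[LHS]/(fine 'E_P[fun t =>
  fps_exp (\sum_(i < N) b i t *: fps_var R i) m]).
under [X in 'E_P[X]%E]eq_fun => t do rewrite expE.
have intE (X : T -> R) : 'E_P[X]%E = (\int[P]_w (X w)%:E)%E by rewrite unlock.
rewrite intE; under eq_integral do rewrite -sumEFin.
have intS (S : {set 'I_N}) : P.-integrable setT
    (fun t => ((\prod_(i in S) b i t) * (\prod_(i in S) fps_e R i) m)%:E).
  under eq_fun do rewrite EFinM; apply: integrableZr => //.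
  exact: integrable_prod01.
rewrite integral_sum //.
under eq_bigr => S _.
  under eq_integral do rewrite EFinM.
  rewrite integralZr //; last exact: integrable_prod01.
  rewrite -[X in (X * _)%E]fineK; last first.
    by apply: integrable_fin_num => //; exact: integrable_prod01.
  rewrite -EFinM.
  over.
rewrite sumEFin /=; apply: eq_bigr => S _.
by rewrite /joint_moment intE.
Qed.

Definition polymer_weight (A : {set 'I_N}) : fps N R :=
  cumulant b A *: \prod_(i in A) fps_e R i.

Lemma polymer_weight0 : polymer_weight finset.set0 = 0.
Proof. by rewrite /polymer_weight /cumulant cumulants_of0 scale0r. Qed.

(** A nonempty polymer carries a factor [fps_e], which has no constant term. Hence [n] polymers have
    order at least [n], and each degree involves finitely many tuples. *)
Lemma vanishes_polymer_weight A : vanishes 1 (polymer_weight A).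
Proof.
have [->|/set0Pn[i iA]] := eqVneq A finset.set0; first by rewrite polymer_weight0.
rewrite /polymer_weight (bigD1 i) //= ; apply: vanishesZ.
by rewrite -[1%N]addn0; apply: vanishesM => //; exact: vanishes_e.
Qed.

(** A disjoint family has fewer than [K] members, so the sum over [n] is complete; 1/n! removes the
    orderings counted by [gas_total]. *)
Lemma generating_function_gas K : (#|{set 'I_N}| < K)%N ->
  fps_expectation P (fun t => fps_exp (\sum_(i < N) b i t *: fps_var R i)) =
  \sum_(n < K) n`!%:R^-1 *: gas_total (@intersects _) polymer_weight 'I_n.
Proof.
move=> NK; rewrite expectation_exp_linear.
transitivity (\sum_(S : {set 'I_N}) \sum_(p | finset.partition p S)
    \prod_(A in p) polymer_weight A).
  apply: eq_bigr => S _; rewrite moment_cumulant scaler_suml.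
  apply: eq_bigr => p pS; rewrite fps_scale_prod; congr (_ *: _).
  exact: set_partition_big.
rewrite sum_partitions (sum_disjoint_families _ NK).
apply: eq_bigr => n _; rewrite gas_total_sets ?polymer_weight0 //.
rewrite -scalerMnr scalerMnl -[_ *+ _]mulr_natr mulVf ?scale1r //.
Qed.

End GeneratingFunction.

(** * From clusters to isomorphism classes of graphs *)

Section ClusterExpansion.
Context d (T : measurableType d) (R : realType) (P : probability T R).
Variables (N : nat) (b : 'I_N -> {RV P >-> R}).

Notation meet := (@intersects _).
Notation z := (polymer_weight b).

Definition cluster n (A : {ffun 'I_n -> {set 'I_N}}) : fps N R :=
  ursell (fps N R) (overlap meet A) finset.setT * \prod_(i < n) z (A i).

(** The factor [u] is arbitrary so as to cover both the Ursell function and the independence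
    indicator. *)
Lemma vanishes_polymers n (A : {ffun 'I_n -> {set 'I_N}}) (u : fps N R) :
  vanishes n (u * \prod_(i < n) z (A i)).
Proof.
apply: (@vanishes_leq _ _ _ (0 + \sum_(i < n) 1)); first by rewrite sum1_card card_ord.
apply: vanishesM => //.
by apply: vanishes_prod => i _; apply: vanishes_polymer_weight.
Qed.

Lemma cluster_connected n (A : {ffun 'I_n -> {set 'I_N}}) : cluster A != 0 ->
  bigraph_connected (tuple_bigraph A) /\
  (2 <= nblack (tuple_bigraph A) + nwhite (tuple_bigraph A))%N.
Proof.
move=> cA; apply: (@tuple_bigraph_connected _ (fps N R)).
  move=> i; apply: contraNneq cA => Ai.
  by rewrite /cluster (bigD1 i) //= Ai polymer_weight0 mul0r mulr0.
by apply: contraNneq cA; rewrite /cluster => ->; rewrite mul0r.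
Qed.

Lemma joint_moment0 (I : finType) (a : I -> {RV P >-> R}) :
  joint_moment a finset.set0 = 1.
Proof.
rewrite /joint_moment; under [X in 'E_P[X]%E]eq_fun do rewrite big_set0.
by rewrite expectation_cst.
Qed.

Lemma cumulant_imset (I J : finType) (a : J -> {RV P >-> R}) (f : I -> J)
    (S : {set I}) : injective f ->
  cumulant (fun i => a (f i)) S = cumulant a (f @: S)%SET.
Proof.
move=> fI; apply: cumulants_of_imset => //; try exact: joint_moment0.
move=> C _; congr (fine 'E_P[_]); apply/funext => t.
by rewrite big_imset //= => i j _ _; apply: fI.
Qed.

(** Each edge factor is assigned to the black endpoint of its edge. *)
Lemma labelling_weight_polymers (H : bigraph) (L : {ffun 'I_(nwhite H) -> 'I_N}) :
  injective L ->
  labelling_weight b L = \prod_(x < nblack H) z (L @: white_nbrs x)%SET.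
Proof.
move=> LI; rewrite /labelling_weight fps_scale_prod; congr (_ *: _).
  by apply: eq_bigr => x _; rewrite cumulant_imset.
rewrite (eq_bigl (fun xy => xpredT xy.1 && (xy.2 \in white_nbrs xy.1))); last first.
  by move=> [x y]; rewrite /= inE.
rewrite -(pair_big_dep xpredT (fun x y => y \in white_nbrs x)
  (fun x y => fps_e R (L y))) /=.
by apply: eq_bigr => x _; rewrite big_imset //= => i j _ _; apply: LI.
Qed.

(** Since [L] is injective, label sets meet exactly when the neighbourhoods do: the overlap graph is
    [black_graph H] renumbered by [s]. *)
Lemma cluster_nbr_tuple (H : bigraph) s (L : {ffun 'I_(nwhite H) -> 'I_N}) :
  bigraph_connected H -> (2 <= nblack H + nwhite H)%N -> injective L ->
  cluster (nbr_tuple (s, L)) =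
  (graph_mobius (black_graph H))%:~R *: labelling_weight b L.
Proof.
move=> Hc H2 LI; have n0 := connected_nblack_gt0 Hc H2.
rewrite labelling_weight_polymers // /cluster [RHS]scaler_int -[RHS]mulrzl.
congr (_ * _); last first.
  by rewrite [RHS](reindex_inj (@perm_inj _ s)); apply: eq_bigr => i _; rewrite ffunE.
rewrite (graph_mobius_ursell _ (Ordinal n0) (black_graph_connected Hc)).
have sT : [set: 'I_(nblack H)]%SET = (s @: finset.setT)%SET.
  by apply/setP => x; rewrite -[x](permKV s) imset_f ?inE.
rewrite [in RHS]sT; apply: ursell_imset => [|i j _ _]; first exact: perm_inj.
rewrite /overlap !ffunE /=.
change ((i != j) && meet (L @: white_nbrs (s i))%SET (L @: white_nbrs (s j))%SET =
  (s i != s j) && (white_nbrs (s i) :&: white_nbrs (s j) != finset.set0)%SET).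
rewrite (inj_eq perm_inj) /intersects -imsetI ?imset_eq0 // => u v _ _.
exact: LI.
Qed.

(** By [orbit_count], the sum over labellings divided by |Aut H| is the sum over the tuples with
    graph [H] divided by n!. *)
Lemma bigraph_term_clusters (H : bigraph) :
  bigraph_connected H -> (2 <= nblack H + nwhite H)%N ->
  bigraph_term b H = (nblack H)`!%:R^-1 *:
    \sum_(A : {ffun 'I_(nblack H) -> {set 'I_N}} | bigraph_iso (tuple_bigraph A) H)
      cluster A.
Proof.
move=> Hc H2; have Hw := white_has_nbr Hc H2.
have E := orbit_count Hw (fun s L => @cluster_nbr_tuple H s L Hc H2).
rewrite (eq_bigl _ _ (fun A => tuple_bigraph_iso A Hw)).
move: E; set S := \sum_(A in _) cluster A => E.
have a0 : #|bigraph_Aut H|%:R != 0 :> R by rewrite pnatr_eq0 -lt0n bigraph_Aut_gt0.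
have f0 : (nblack H)`!%:R != 0 :> R by rewrite pnatr_eq0 -lt0n fact_gt0.
have -> : S = #|bigraph_Aut H|%:R^-1 *: (S *+ #|bigraph_Aut H|).
  by rewrite -[S *+ _]scaler_nat scalerA mulVf // scale1r.
rewrite -E -scaler_sumr -[(_ *: _) *+ _]scaler_nat !scalerA.
by rewrite [_^-1 / _]mulrC mulrA divfK // [_^-1 * _]mulrC.
Qed.

Definition cluster_class n (A : {ffun 'I_n -> {set 'I_N}}) :=
  (\pi_{eq_quot bigraph_equiv} (tuple_bigraph A))%qT.

Lemma cluster_classE n (A : {ffun 'I_n -> {set 'I_N}}) C :
  (cluster_class A == C) = bigraph_iso (tuple_bigraph A) (repr C).
Proof. by rewrite -{1}[C]reprK /cluster_class eqmodE. Qed.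

(** A finite list that supports all coefficients of degree below [M], because a cluster of [n]
    polymers has order at least [n]. *)
Definition cluster_classes M :=
  undup [seq cluster_class A | n <- iota 0 M,
    A <- [seq A <- enum {: {ffun 'I_n -> {set 'I_N}}} | cluster A != 0]].

Lemma cluster_classesP M C :
  reflect (exists2 n, (n < M)%N &
    exists2 A : {ffun 'I_n -> {set 'I_N}}, cluster A != 0 & C = cluster_class A)
    (C \in cluster_classes M).
Proof.
rewrite mem_undup; apply: (iffP allpairsPdep) => [[n [A [nM AM ->]]]|[n nM [A cA ->]]].
  exists n; first by rewrite mem_iota in nM.
  by exists A => //; move: AM; rewrite mem_filter => /andP[].
by exists n, A; rewrite mem_iota mem_filter cA mem_enum; split.
Qed.

Lemma cluster_class_connected n (A : {ffun 'I_n -> {set 'I_N}}) :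
  cluster A != 0 -> connected_bigraph_classes (cluster_class A).
Proof.
move=> cA; have [Hc H2] := cluster_connected cA.
have iso : bigraph_iso (tuple_bigraph A) (repr (cluster_class A)).
  by rewrite -cluster_classE.
split; first exact: bigraph_iso_connected iso Hc.
by rewrite -(bigraph_iso_order iso).
Qed.

Lemma bigraph_term_coef C m : connected_bigraph_classes C ->
  bigraph_term b (repr C) m = (nblack (repr C))`!%:R^-1 *
    \sum_(A : {ffun 'I_(nblack (repr C)) -> {set 'I_N}} | cluster_class A == C)
      cluster A m.
Proof.
case=> Hc H2; rewrite bigraph_term_clusters //.
rewrite fps_coefZ fps_coef_sum; congr (_ * _).
by apply: eq_bigl => A; rewrite cluster_classE.
Qed.

Lemma mem_cluster_classes M C m : (expo_deg m < M)%N ->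
  connected_bigraph_classes C -> bigraph_term b (repr C) m != 0 ->
  C \in cluster_classes M.
Proof.
move=> mM DC; rewrite bigraph_term_coef //; apply: contra_neqT => nC.
rewrite big1 ?mulr0 // => A /eqP AC; apply: contraNeq nC => cAm.
have nm : (nblack (repr C) <= expo_deg m)%N.
  by rewrite leqNgt; apply: contraNN cAm => mn; rewrite vanishes_polymers.
apply/cluster_classesP; exists (nblack (repr C)); first exact: leq_ltn_trans mM.
by exists A => //; apply: contraNneq cAm => ->.
Qed.

Lemma bigraph_terms_summable :
  fps_summable connected_bigraph_classes (fun C => bigraph_term b (repr C)).
Proof.
move=> m.
apply: (@sub_finite_set _ _ [set` cluster_classes (expo_deg m).+1]) => [C [DC Cm]|].
  exact: mem_cluster_classes Cm.
exact: finite_seq.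
Qed.

Lemma sum_bigraph_terms M m : (expo_deg m < M)%N ->
  fps_sum connected_bigraph_classes (fun C => bigraph_term b (repr C)) m =
  (\sum_(n < M) n`!%:R^-1 *: gas_connected meet z 'I_n) m.
Proof.
move=> mM.
rewrite (@fps_sum_seq _ _ _ _ _ (cluster_classes M)) ?undup_uniq //; last 2 first.
- by move=> C /cluster_classesP[n _ [A cA ->]]; apply: cluster_class_connected.
- by move=> C DC; apply: contraNeq; apply: mem_cluster_classes.
rewrite fps_coef_sum.
(* Only the size [n = nblack (repr C)] contributes to a class [C], so the sum may range over all [n]
   and be exchanged with the sum over classes. *)
transitivity (\sum_(C <- cluster_classes M) \sum_(n < M) n`!%:R^-1 *
    \sum_(A : {ffun 'I_n -> {set 'I_N}} | cluster_class A == C) cluster A m).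
  rewrite big_seq [RHS]big_seq; apply: eq_bigr => C /cluster_classesP[n nM [A cA CA]].
  have iso : bigraph_iso (tuple_bigraph A) (repr C) by rewrite -cluster_classE CA.
  have nC : nblack (repr C) = n by rewrite -(bigraph_iso_nblack iso).
  have CM : (nblack (repr C) < M)%N by rewrite nC.
  rewrite bigraph_term_coef; last by rewrite CA; apply: cluster_class_connected.
  rewrite (bigD1 (Ordinal CM)) //= [X in _ + X]big1 ?addr0 // => k kC.
  rewrite big_pred0 ?mulr0 // => B; rewrite cluster_classE; apply: contraNF kC.
  by move=> /bigraph_iso_nblack /= kE; apply/eqP/val_inj; rewrite /= -kE.
rewrite exchange_big; apply: eq_bigr => n _; rewrite -mulr_sumr.
have -> : gas_connected meet z 'I_n =
  \sum_(A : {ffun 'I_n -> {set 'I_N}}) cluster A by [].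
rewrite fps_coefZ fps_coef_sum; congr (_ * _).
rewrite (exchange_big_dep xpredT) //; apply: eq_bigr => A _.
have [->|cAm] := eqVneq (cluster A m) 0; first by rewrite big1.
have AM : cluster_class A \in cluster_classes M.
  apply/cluster_classesP; exists (nat_of_ord n); first exact: ltn_ord.
  by exists A => //; apply: contraNneq cAm => ->.
rewrite big_mkcond (bigD1_seq (cluster_class A)) ?undup_uniq // eqxx.
rewrite big1; first exact: addr0.
by move=> C; rewrite eq_sym => /negPf ->.
Qed.

End ClusterExpansion.

Theorem proposition4 (d : measure_display) (T : measurableType d)
    (R : realType) (P : probability T R) (N : nat) (b : 'I_N -> {RV P >-> R})
    (b01 : forall (i : 'I_N) (t : T), b i t = 0 \/ b i t = 1) :
  fps_summable connected_bigraph_classes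
    (fun C : bigraph_class => bigraph_term b (repr C)) /\
  fps_log (fps_expectation P
    (fun t => fps_exp (\sum_(i < N) b i t *: fps_var R i))) =
  fps_sum connected_bigraph_classes
    (fun C : bigraph_class => bigraph_term b (repr C)).
Proof.
split; first exact: bigraph_terms_summable.
(* [K] is at least the degree of [m], so truncations are exact there, and [K.+1] exceeds the number
   of subsets, so the partition function is complete. *)
apply/fpsP => m; pose K := (expo_deg m + #|{set 'I_N}|)%N.
have mK : (expo_deg m < K.+1)%N by rewrite ltnS leq_addr.
pose a n := n`!%:R^-1 *: gas_total (@intersects _) (polymer_weight b) 'I_n : fps N R.
pose c n := n`!%:R^-1 *: gas_connected (@intersects _) (polymer_weight b) 'I_n : fps N R.
have NK : (#|{set 'I_N}| < K.+1)%N by rewrite ltnS leq_addl.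
have sa : _ = \sum_(n < K.+1) a n := generating_function_gas b01 NK.
have sc : _ = (\sum_(n < K.+1) c n) m := sum_bigraph_terms b mK.
rewrite sa sc {sa sc}.
have a0 : a 0 = 1 by rewrite /a gas_total0 invr1 scale1r.
have c0 : c 0 = 0 by rewrite /c gas_connected0 scaler0.
have va n : vanishes n (a n).
  by apply: vanishesZ; apply: vanishes_sum => A _; apply: vanishes_polymers.
have vc n : vanishes n (c n).
  by apply: vanishesZ; apply: vanishes_sum => A _; apply: vanishes_polymers.
(* This is [gas_total_rec] divided by n!, which splits the binomial coefficient into 1/k! and
   1/(n-k)!. *)
have ac n : a n.+1 *+ n.+1 = \sum_(k < n.+1) (c k.+1 *+ k.+1) * a (n - k)%N.
  have fS k (f : fps N R) : (k.+1`!%:R^-1 *: f) *+ k.+1 = k`!%:R^-1 *: f.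
    have k0 : k.+1%:R != 0 :> R by rewrite pnatr_eq0.
    rewrite scalerMnl -[_ *+ _]mulr_natr factS natrM invfM; congr (_ *: _).
    by rewrite mulrAC mulVf // mul1r.
  rewrite /a fS gas_total_rec scaler_sumr; apply: eq_bigr => k _.
  rewrite /c fS fps_scaleM -[_ *: (_ *+ _)]scalerMnr [LHS]scalerMnl.
  by rewrite invf_fact_bin // -ltnS.
have Z0 : (\sum_(n < K.+1) a n) 0 = 1.
  rewrite fps_coef_sum big_ord_recl [a ord0]a0 big1 ?addr0; first by rewrite /= eqxx.
  move=> n _; apply: va.
  by rewrite /expo_deg big1 // => i _; rewrite ffunE.
rewrite (@fps_log_coef _ _ _ K) // ?leq_addr //.
apply/eqP; rewrite -subr_eq0; apply/eqP.
exact: (log_recursion a0 c0 va vc ac).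
Qed.
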